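(* Fix constants $0<\hat\beta_{\min}\le\hat\beta_{\max}<\frac14\bar\beta<1$, independent of $N$. There exist constants $c,C>0$, depending only on $\hat\beta_{\min}$ and $\hat\beta_{\max}$, such that the following holds. For every $N$ let $h=h_N$ be an integer and let $\hat{\boldsymbol\beta}=(\hat\beta_e)_{e\in\Pi_h}$ (possibly depending on $N$) satisfy $\hat\beta_{\min}\le\hat\beta_e\le\hat\beta_{\max}$ for all $e\in\Pi_h$. Suppose that $h_N\to\infty$ and $h_N=o(\sqrt L)$ as $N\to\infty$, where $L=\log N$. Then, for all sufficiently large $N$, $$\mathcal M^h_{N,\hat{\boldsymbol\beta}}\le\Big(\prod_{e\in\Pi_h}\frac1{1-\hat\beta_e}\Big)\exp\Big\{C\Big(\frac{h^3}{L}+\frac{h^6}{L^2}\Big)\Big\}+e^{-ch^2}.$$ Consequently, if $h_N=o(L^{1/3})$ (here $h_N\to\infty$ is not required), then $$\limsup_{N\to\infty}\Big(\mathcal M^h_{N,\hat{\boldsymbol\beta}}\prod_{e\in\Pi_h}(1-\hat\beta_e)\Big)\le1 .$$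
   Context: $\Pi_h$ is the set of all unordered pairs $e=\{i,j\}$ with $1\le i<j\le h$. Let $S^1,\dots,S^h$ be independent simple symmetric random walks on $\mathbb Z^2$, all started from the origin, with joint expectation $\mathsf E^{\otimes h}$. For $e=\{i,j\}\in\Pi_h$ let $\mathsf L^{e}_N=\sum_{n=1}^N\mathbf 1_{\{S^i_n=S^j_n\}}$, and define $$\mathcal M^h_{N,\hat{\boldsymbol\beta}}:=\mathsf E^{\otimes h}\Big[\exp\Big(\sum_{e\in\Pi_h}\frac{\pi\hat\beta_e}{\log N}\,\mathsf L^{e}_N\Big)\Big].$$ The number $\bar\beta\in(0,1/72)$ is the fixed constant from the following known theorem of Cosco and Zeitouni: in the homogeneous case $\hat\beta_e\equiv\hat\beta\in(0,\bar\beta)$ and for $h=h_N\le C\sqrt{\log N}$ with some $C>0$, one has $\mathcal M^h_{N,\hat{\boldsymbol\beta}}=\big(\tfrac1{1-\hat\beta}\big)^{\binom h2(1+o(1))}$ as $N\to\infty$. *)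

(* Defs.v *)
From HB Require Import structures.
From mathcomp Require Import all_boot all_order all_algebra.
From mathcomp Require Import all_classical all_reals all_analysis.
Set Implicit Arguments.
Unset Strict Implicit.
Unset Printing Implicit Defensive.
Import Order.TTheory GRing.Theory Num.Theory.
Import numFieldNormedType.Exports.
Local Open Scope classical_set_scope.
Local Open Scope ring_scope.

Definition unit_steps : seq (int * int) :=
  [:: (1, 0); (-1, 0); (0, 1); (0, -1)].

(* [int * int] carries the discrete sigma-algebra: measurability of a variable
   X means that all preimages X @^-1` A are measurable. *)
Definition mutually_independent d (T : measurableType d) (R : realType)
    (P : probability T R) (I : eqType) (X : I -> T -> int * int) : Prop :=
  forall (J : seq I) (A : I -> set (int * int)), uniq J ->
    P (\bigcap_(j in [set` J]) (X j @^-1` A j)) =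
    (\prod_(j <- J) P (X j @^-1` A j))%E.

Definition increment (T : Type) (S : nat -> nat -> T -> int * int)
    (k : nat * nat) (t : T) : int * int :=
  S k.1 k.2.+1 t - S k.1 k.2 t.

(* [S i n t] is the position at time n of the i-th walk. Independence of all
   increments (i, n) expresses both that each walk has independent increments
   and that the walks are independent of each other. *)
Definition independent_srws d (T : measurableType d) (R : realType)
    (P : probability T R) (S : nat -> nat -> T -> int * int) : Prop :=
  [/\ forall i t, S i 0%N t = 0,
      forall k (A : set (int * int)), measurable (increment S k @^-1` A),
      forall k z, z \in unit_steps ->
        P (increment S k @^-1` [set z]) = (4^-1)%:E
    & mutually_independent P (increment S)].

Definition Pairs (h : nat) : {set 'I_h * 'I_h} :=
  [set e : 'I_h * 'I_h | (e.1 < e.2)%N]%SET.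

Definition collision_time (T : Type) (S : nat -> nat -> T -> int * int)
    (N i j : nat) (t : T) : nat :=
  (\sum_(1 <= n < N.+1) (S i n t == S j n t))%N.

(* Only the values of [b] on [Pairs h] matter. *)
Definition moment d (T : measurableType d) (R : realType)
    (P : probability T R) (S : nat -> nat -> T -> int * int)
    (N h : nat) (b : 'I_h * 'I_h -> R) : \bar R :=
  ('E_P[fun t => expR (\sum_(e in Pairs h)
     pi * b e / ln N%:R * (collision_time S N e.1 e.2 t)%:R)])%E.

(* The property of the constant bbar given by the theorem of Cosco and
   Zeitouni on homogeneous interactions; [eps] is the o(1) in the exponent. *)
Definition Cosco_Zeitouni (R : realType) (bbar : R) : Prop :=
  forall b : R, 0 < b < bbar ->
  exists2 C : R, 0 < C &
  forall d (T : measurableType d) (P : probability T R)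
    (S : nat -> nat -> T -> int * int), independent_srws P S ->
  forall h : nat -> nat,
    (\forall N \near \oo, (h N)%:R <= C * Num.sqrt (ln (N%:R : R))) ->
  exists2 eps : nat -> R, eps N @[N --> \oo] --> 0 &
    \forall N \near \oo,
      moment P S N (fun _ : 'I_(h N) * 'I_(h N) => b) =
      (((1 - b)^-1 `^ ('C(h N, 2)%:R * (1 + eps N)))%:E)%E.

(* Main.v *)
Require Import Defs.
From HB Require Import structures.
From mathcomp Require Import all_boot all_order all_algebra.
From mathcomp Require Import all_classical all_reals all_analysis.
From mathcomp Require Import measurable_realfun.
From mathcomp Require Import ring lra zify.
Import Order.TTheory GRing.Theory Num.Theory.
Import numFieldNormedType.Exports.
Set Implicit Arguments.
Unset Strict Implicit.
Unset Printing Implicit Defensive.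
Local Open Scope classical_set_scope.
Local Open Scope ring_scope.

(** Write L for the logarithm of the time horizon N.  The moment is the value at
    the origin of a discrete Feynman-Kac recursion for h walkers
    ([moment_partition_function]), and the theorem follows from an explicit
    supersolution of this recursion ([partition_function_le]), which yields
    the product of the 1 / (1 - b e) times exp (C h^3 / L) as soon as h^2 is a
    small multiple of L ([moment_le]).

    If the differences of the walkers were independent, the product over the
    pairs of the two body profiles 1 + kappa_e G(n, .) would be an exact
    supersolution: G(n, z) is the expected number of collisions, within n
    steps, of two walkers at distance z, and kappa_e = sigma_e (1 + kappa_e
    G(N, 0)) with sigma_e = exp (pi b e / L) - 1.  At the origin the profile is
    1 / (1 - sigma_e G(N, 0)), and the Wallis bound on the central binomial
    coefficient gives G(N, 0) <= (1 + L) / pi, so that each pair costs only a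
    factor 1 + O(1/L) more than 1 / (1 - b e).

    The differences are correlated through shared walkers.  In one step the
    weight of a pair varies by O(1/L) times the inverse distance of the two
    walkers, because kappa = O(1/L) and the gradient of G is bounded by the
    inverse distance ([green_step]).  Centred weights of pairs without a common
    walker are uncorrelated, so the mean of the product of all weights exceeds
    1 by at most a constant times L^-2 times the sum, over pairs of adjacent
    pairs, of the products of the two inverse distances
    ([mean_prod_centered], [sum_adjacent_le]).  This uses that h^2 / L is small,
    which keeps the products of the remaining weights bounded.

    The excess is compensated by a function of three walkers ([corrector]) whose
    drift is at most minus a constant times the inverse distance of two of
    them divided by the size of their triangle ([mean_corrector_incr]).  It
    exists, with values O(L), because the three walkers form, up to their
    centre of mass, a walk in four dimensions, where the logarithm of the
    distance is strictly subharmonic.  Adding L^-2 times its sum over all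
    triples in the exponent costs a factor exp (O(h^3 / L)) at the origin.  The
    cross terms between correctors and weights are of smaller order, again
    because pairs disjoint from a triple are independent of it ([one_step_le1]). *)

(** A step of a walk in the lattice rotated by 45 degrees, where its two
    coordinates move independently; coordinates count forward moves, so that
    each of them grows by 0 or 1. *)
Local Notation step := (bool * bool)%type.

(** * Uniform means over finite configurations and nearly independent products *)

Definition mean (R : realType) (A : finType) (f : A -> R) : R :=
  #|A|%:R^-1 * \sum_a f a.

Section Mean.
Variables (R : realType) (A : finType).
Hypothesis A_gt0 : (0 < #|A|)%N.
Implicit Types f g : A -> R.

Lemma mean_cst (c : R) : mean (fun _ : A => c) = c.
Proof.
rewrite /mean sumr_const -[c *+ _]mulr_natl mulrA mulVf ?mul1r//.
by rewrite pnatr_eq0 -lt0n.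
Qed.

Lemma meanD f g : mean (fun a => f a + g a) = mean f + mean g.
Proof. by rewrite /mean big_split /= mulrDr. Qed.

Lemma meanZ (c : R) f : mean (fun a => c * f a) = c * mean f.
Proof. by rewrite /mean -mulr_sumr mulrCA. Qed.

Lemma meanB f g : mean (fun a => f a - g a) = mean f - mean g.
Proof. by rewrite /mean sumrB mulrBr. Qed.

Lemma mean_sum (I : Type) (s : seq I) (P : pred I) (F : I -> A -> R) :
  mean (fun a => \sum_(i <- s | P i) F i a) = \sum_(i <- s | P i) mean (F i).
Proof. by rewrite /mean exchange_big /= mulr_sumr. Qed.

Lemma ler_mean f g : (forall a, f a <= g a) -> mean f <= mean g.
Proof. by move=> fg; rewrite ler_wpM2l// ler_sum. Qed.

Lemma mean_norm_le f (c : R) : (forall a, `|f a| <= c) -> `|mean f| <= c.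
Proof.
move=> fc; rewrite ler_norml; apply/andP; split.
  rewrite -(mean_cst (- c)); apply: ler_mean => a.
  by have := fc a; rewrite ler_norml => /andP[].
rewrite -[leRHS](mean_cst c); apply: ler_mean => a.
by have := fc a; rewrite ler_norml => /andP[].
Qed.

Lemma eq_mean f g : f =1 g -> mean f = mean g.
Proof. by move=> fg; rewrite /mean (eq_bigr g). Qed.

End Mean.

Definition depends_on (I : finType) (B R : Type) (D : {set I})
    (f : {ffun I -> B} -> R) : Prop :=
  forall a b : {ffun I -> B}, {in D, a =1 b} -> f a = f b.

Section Independence.
Variables (R : realType) (I B : finType).
Implicit Types (D : {set I}) (f g : {ffun I -> B} -> R).

Lemma depends_on_prod (E : Type) (s : seq E) (P : pred E) D
    (F : E -> {ffun I -> B} -> R) :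
  (forall e, P e -> depends_on D (F e)) ->
  depends_on D (fun a => \prod_(e <- s | P e) F e a).
Proof. by move=> FD a b ab; apply: eq_bigr => e /FD; apply. Qed.

Definition glue D (a b : {ffun I -> B}) : {ffun I -> B} :=
  [ffun i => if i \in D then a i else b i].

(** Exchanging the coordinates outside [D] of two configurations is an
    involution of the pairs of configurations. *)
Lemma mean_prod_indep D f g : depends_on D f -> depends_on (~: D) g ->
  mean (fun a => f a * g a) = mean f * mean g.
Proof.
move=> fD gD; have [B0|A0] := posnP #|{ffun I -> B}|.
  by rewrite /mean B0 invr0 !mul0r.
pose sw (p : {ffun I -> B} * {ffun I -> B}) :=
  (glue D p.1 p.2, glue D p.2 p.1).
have swK : involutive sw.
  move=> [a b]; rewrite /sw /=.
  by congr (_, _); apply/ffunP => i; rewrite !ffunE; case: (i \in D).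
have -> : mean f * mean g =
    #|{ffun I -> B}|%:R^-1 * #|{ffun I -> B}|%:R^-1 * \sum_p f p.1 * g p.2.
  rewrite /mean mulrACA; congr (_ * _).
  rewrite mulr_suml -(pair_bigA _ (fun a b => f a * g b)) /=.
  by apply: eq_bigr => a _; rewrite mulr_sumr.
have -> : \sum_p f p.1 * g p.2 = \sum_p f (sw p).1 * g (sw p).1.
  apply: eq_bigr => -[a b] _ /=; congr (_ * _).
    by apply: fD => i iD; rewrite ffunE iD.
  by apply: gD => i; rewrite finset.in_setC => /negbTE iD; rewrite ffunE iD.
rewrite -(reindex_inj (inv_inj swK) (P := xpredT)
  (F := fun p => f p.1 * g p.1)) /=.
rewrite -(pair_bigA _ (fun a b => f a * g a)) /=.
rewrite (eq_bigr (fun a => #|{ffun I -> B}|%:R * (f a * g a))); last first.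
  by move=> a _; rewrite sumr_const mulr_natl.
by rewrite -mulr_sumr mulrACA mulVf ?mul1r ?mulr1// pnatr_eq0 -lt0n.
Qed.

End Independence.

Section NearOneProducts.
Variables (R : realType) (E : eqType).

Lemma prod_near1 (s : seq E) (P : pred E) (x eps : E -> R) :
  (forall e, e \in s -> `|x e| <= eps e) ->
  \sum_(e <- s) eps e <= 1 / 4 ->
  `|\prod_(e <- s | P e) (1 + x e) - 1| <= 2 * \sum_(e <- s | P e) eps e.
Proof.
elim: s => [|e s IH] xs; first by rewrite !big_nil subrr normr0 mulr0.
have eps0 e' : e' \in e :: s -> 0 <= eps e' by move=> /xs; apply: le_trans.
have epse : 0 <= eps e by apply: eps0; rewrite mem_head.
rewrite !big_cons => s14.
have epss : 0 <= \sum_(e <- s | P e) eps e.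
  by rewrite big_seq_cond sumr_ge0// => e' /andP[e's _]; rewrite eps0// inE e's orbT.
have lePs : \sum_(e <- s | P e) eps e <= \sum_(e <- s) eps e.
  rewrite [leRHS](bigID P) /= lerDl big_seq_cond sumr_ge0// => e' /andP[e's _].
  by rewrite eps0// inE e's orbT.
have {IH} := IH (fun e' e's => xs e' (mem_behead (s := e :: s) e's)).
move=> /(_ ltac:(lra)).
set p := \prod_(e <- s | P e) _; set S := \sum_(e <- s | P e) _ in epss lePs *.
case: (P e) => // IH.
have -> : (1 + x e) * p - 1 = (p - 1) + x e * (1 + (p - 1)) by ring.
apply: (le_trans (ler_normD _ _)); rewrite normrM.
have h1 : `|x e| <= eps e by apply: xs; rewrite mem_head.
have h2 : `|1 + (p - 1)| <= 2.
  apply: (le_trans (ler_normD _ _)); rewrite normr1; lra.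
have : `|x e| * `|1 + (p - 1)| <= eps e * 2 by rewrite ler_pM.
lra.
Qed.

End NearOneProducts.
Section Cluster.
Variables (R : realType) (I B E : finType).
Hypothesis B_gt0 : (0 < #|B|)%N.
Variables (supp : E -> {set I}) (x : E -> {ffun I -> B} -> R) (eps : E -> R).
Hypothesis x_dep : forall e, depends_on (supp e) (x e).
Hypothesis x_le : forall e a, `|x e a| <= eps e.

Let A_gt0 : (0 < #|{ffun I -> B}|)%N.
Proof. by rewrite card_ffun expn_gt0 B_gt0. Qed.

Let eps_ge0 e : 0 <= eps e.
Proof.
have /card_gt0P[a _] : (0 < #|{: {ffun I -> B}}|)%N := A_gt0.
exact: le_trans (x_le e a).
Qed.

Definition touches (D : {set I}) (e : E) := ~~ [disjoint D & supp e].

(** Only the factors that share a coordinate with [D] are correlated with a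
    function of the coordinates in [D]. *)
Lemma mean_mul_prod (D : {set I}) (f : {ffun I -> B} -> R) (delta : R)
    (s : seq E) :
  depends_on D f -> (forall a, `|f a| <= delta) ->
  \sum_(e <- s) eps e <= 1 / 4 ->
  mean (fun a => f a * \prod_(e <- s) (1 + x e a)) <=
  mean f * mean (fun a => \prod_(e <- s | ~~ touches D e) (1 + x e a))
    + 4 * delta * \sum_(e <- s | touches D e) eps e.
Proof.
move=> fD fle s14.
have delta0 : 0 <= delta.
  have /card_gt0P[a _] : (0 < #|{: {ffun I -> B}}|)%N := A_gt0.
  exact: le_trans (fle a).
rewrite -(@mean_prod_indep _ _ _ D)//; last first.
  apply: depends_on_prod => e; rewrite negbK => De a b ab; congr (1 + _).
  apply: x_dep => i ie; apply: ab; rewrite inE.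
  by apply: contraL De => iD; apply/pred0Pn; exists i; rewrite /= iD.
rewrite -lerBlDl -meanB.
apply: (le_trans (ler_norm _)); apply: mean_norm_le => // a.
rewrite (bigID (touches D)) /=.
set p := \prod_(e <- s | touches D e) _; set q := \prod_(e <- s | ~~ touches D e) _.
have hp : `|p - 1| <= 2 * \sum_(e <- s | touches D e) eps e.
  by apply: prod_near1 => // e _.
have hq : `|q - 1| <= 1 / 2.
  apply: (@le_trans _ _ (2 * \sum_(e <- s | ~~ touches D e) eps e)).
    by apply: prod_near1 => // e _.
  have : \sum_(e <- s | ~~ touches D e) eps e <= \sum_(e <- s) eps e.
    by rewrite [leRHS](bigID (touches D)) /= lerDr sumr_ge0.
  by lra.
have hq2 : `|q| <= 2.
  by rewrite -[q](subrK 1); apply: (le_trans (ler_normD _ _)); rewrite normr1; lra.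
have -> : f a * (p * q) - f a * q = (p - 1) * (f a * q) by ring.
rewrite !normrM.
set S := \sum_(e <- s | _) _ in hp *.
have S0 : 0 <= S by apply: sumr_ge0.
have -> : 4 * delta * S = (2 * S) * (delta * 2) by ring.
by rewrite ler_pM// ler_pM.
Qed.

(** Each factor is correlated only with the factors that it touches, so
    multiplying centred factors in one after the other costs only products of
    two touching bounds. *)
Lemma mean_prod_centered (s : seq E) : uniq s -> (forall e, mean (x e) = 0) ->
  \sum_(e <- s) eps e <= 1 / 4 ->
  mean (fun a => \prod_(e <- s) (1 + x e a)) <=
  1 + 4 * \sum_(e <- s) \sum_(e' <- s | (e' != e) && touches (supp e) e')
            eps e * eps e'.
Proof.
move=> + x0; elim: s => [|e s IH].
  rewrite !big_nil mulr0 addr0 => _ _; under eq_mean do rewrite big_nil.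
  by rewrite mean_cst.
rewrite cons_uniq => /andP[es us]; rewrite big_cons => s14.
have s14' : \sum_(e <- s) eps e <= 1 / 4.
  by apply: le_trans s14; rewrite lerDr.
under eq_mean do rewrite big_cons mulrDl mul1r.
rewrite meanD.
have h1 := IH us s14'.
have h2 := mean_mul_prod (x_dep (e := e)) (x_le e) s14'.
rewrite x0 mul0r add0r in h2.
apply: (le_trans (lerD h1 h2)).
rewrite -addrA lerD2l -mulrA -mulrDr ler_wpM2l//.
rewrite big_cons addrC lerD//.
  rewrite big_cons eqxx /= mulr_sumr big_seq_cond [leRHS]big_seq_cond.
  rewrite le_eqVlt; apply/orP; left; apply/eqP; apply: eq_bigl => e' /=.
  case: (boolP (e' \in s)) => //= e's.
  by have -> : e' != e by apply: contraNneq es => <-.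
apply: ler_sum => e' _; rewrite big_cons; case: ifP => // _.
by rewrite lerDr mulr_ge0.
Qed.

End Cluster.

(** * Sums over triples of distinct indices *)

Definition distinct3 (I : eqType) (i j k : I) := [&& i != j, i != k & j != k].

Definition sum3 (R : realType) (I : finType) (F : I -> I -> I -> R) : R :=
  \sum_i \sum_j \sum_(k | distinct3 i j k) F i j k.

Section Sum3.
Variables (R : realType) (I : finType).
Implicit Types F G : I -> I -> I -> R.

Lemma sum3_swap12 F : sum3 F = sum3 (fun i j k => F j i k).
Proof.
rewrite /sum3 exchange_big; apply: eq_bigr => i _; apply: eq_bigr => j _ /=.
by apply: eq_bigl => k; rewrite /distinct3 eq_sym [(i != k) && _]andbC.
Qed.

Lemma sum3_swap23 F : sum3 F = sum3 (fun i j k => F i k j).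
Proof.
apply: eq_bigr => i _; rewrite (exchange_big_dep xpredT)//=.
apply: eq_bigr => j _; apply: eq_bigl => k.
by rewrite /distinct3 andbCA [j == k]eq_sym.
Qed.

Lemma ler_sum3 F G :
  (forall i j k, distinct3 i j k -> F i j k <= G i j k) -> sum3 F <= sum3 G.
Proof. by move=> FG; do 3 apply: ler_sum => ? ?; apply: FG. Qed.

Lemma sum3_ge0 F : (forall i j k, distinct3 i j k -> 0 <= F i j k) -> 0 <= sum3 F.
Proof. by move=> F0; do 3 apply: sumr_ge0 => ? ?; apply: F0. Qed.

Lemma sum3D F G : sum3 (fun i j k => F i j k + G i j k) = sum3 F + sum3 G.
Proof.
rewrite /sum3 -big_split; apply: eq_bigr => i _.
by rewrite -big_split; apply: eq_bigr => j _; rewrite -big_split.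
Qed.

Lemma sum3Z c F : sum3 (fun i j k => c * F i j k) = c * sum3 F.
Proof.
rewrite /sum3 mulr_sumr; apply: eq_bigr => i _.
by rewrite mulr_sumr; apply: eq_bigr => j _; rewrite mulr_sumr.
Qed.

Lemma sum3_le_card F c : (forall i j k, distinct3 i j k -> F i j k <= c) ->
  0 <= c -> sum3 F <= #|I|%:R ^+ 3 * c.
Proof.
move=> Fc c0.
have -> : #|I|%:R ^+ 3 * c = \sum_(i : I) \sum_(j : I) \sum_(k : I) c.
  rewrite !sumr_const -!mulrnA -[c *+ _]mulr_natl !natrM.
  by rewrite exprS expr2 mulrA.
apply: ler_sum => i _; apply: ler_sum => j _; rewrite big_mkcond ler_sum// => k _.
by case: ifP => // /Fc.
Qed.

Lemma mean_sum3 (A : finType) (F : I -> I -> I -> A -> R) :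
  mean (fun a => sum3 (fun i j k => F i j k a)) = sum3 (fun i j k => mean (F i j k)).
Proof.
rewrite /sum3 mean_sum; apply: eq_bigr => i _.
by rewrite mean_sum; apply: eq_bigr => j _; rewrite mean_sum.
Qed.

(** Jensen's inequality. *)
Lemma sum3_sqr_le F : (forall i j k, distinct3 i j k -> 0 <= F i j k) ->
  (sum3 F) ^+ 2 <= #|I|%:R ^+ 3 * sum3 (fun i j k => F i j k ^+ 2).
Proof.
move=> F0; have [I0|I0] := posnP #|I|.
  by rewrite [sum3 F]big_pred0 ?expr0n ?mulr_ge0//;
    [apply: sum3_ge0 => *; exact: sqr_ge0|move=> i; have := fintype0 i I0].
set n := #|I|%:R ^+ 3; have n0 : 0 < n by rewrite exprn_gt0// ltr0n.
(* the variance of F is nonnegative *)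
have : 0 <= sum3 (fun i j k => (F i j k - sum3 F / n) ^+ 2).
  by apply: sum3_ge0 => *; exact: sqr_ge0.
rewrite (_ : (fun i j k => _) = fun i j k => F i j k ^+ 2 +
    ((- 2 * (sum3 F / n)) * F i j k + (sum3 F / n) ^+ 2)); last first.
  by apply/funext => i; apply/funext => j; apply/funext => k; ring.
rewrite !sum3D sum3Z.
have : sum3 (fun _ _ _ : I => (sum3 F / n) ^+ 2) <= n * (sum3 F / n) ^+ 2.
  by apply: sum3_le_card => //; exact: sqr_ge0.
have -> : n * (sum3 F / n) ^+ 2 = sum3 F ^+ 2 / n by field; rewrite gt_eqF.
have -> : - 2 * (sum3 F / n) * sum3 F = - 2 * (sum3 F ^+ 2 / n) by ring.
move=> h1 h2; rewrite mulrC -ler_pdivrMr//; lra.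
Qed.

End Sum3.

(** Ordered sums are easier to rearrange, and sums over ordered triples count
    every pair of a triple alike. *)
Lemma sum_Pairs_sym (R : realType) (h : nat) (F : 'I_h -> 'I_h -> R) :
  \sum_(e in Pairs h) (F e.1 e.2 + F e.2 e.1) =
  \sum_i \sum_(j | i != j) F i j.
Proof.
rewrite big_split /=.
have e1 (G : 'I_h -> 'I_h -> R) : \sum_(e in Pairs h) G e.1 e.2 =
    \sum_(i : 'I_h) \sum_(j : 'I_h | (i < j)%N) G i j.
  by rewrite pair_big_dep /=; apply: eq_bigl => e; rewrite inE.
rewrite (e1 F) (e1 (fun i j => F j i)).
rewrite [X in _ + X](exchange_big_dep xpredT)//= -big_split /=.
apply: eq_bigr => i _.
rewrite [RHS](bigID (fun j : 'I_h => (i < j)%N)) /=; congr (_ + _).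
  by apply: eq_bigl => j; rewrite -val_eqE /=; case: ltngtP.
by apply: eq_bigl => j; rewrite -val_eqE /=; case: ltngtP.
Qed.

Section OneStep.
Variables (R : realType) (h : nat).
Variables (y : 'I_h -> 'I_h -> R) (m : 'I_h -> 'I_h -> 'I_h -> R).
Hypothesis y_ge0 : forall i j, 0 <= y i j.
Hypothesis y_le1 : forall i j, y i j <= 1.
Hypothesis y_sym : forall i j, y i j = y j i.

Definition pair_set (e : 'I_h * 'I_h) : {set 'I_h} := [set e.1; e.2]%SET.

Lemma sum_touching (D : {set 'I_h}) (w : 'I_h -> 'I_h -> R) :
  (forall i j, 0 <= w i j) -> (forall i j, w i j = w j i) ->
  \sum_(e in Pairs h | ~~ [disjoint D & pair_set e]) w e.1 e.2 <=
  \sum_(i in D) \sum_(j | i != j) w i j.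
Proof.
move=> w0 wsym.
have -> : \sum_(i in D) \sum_(j | i != j) w i j =
    \sum_i \sum_(j | i != j) (i \in D)%:R * w i j.
  rewrite big_mkcond; apply: eq_bigr => i _; case: (i \in D).
    by apply: eq_bigr => j _; rewrite mul1r.
  by rewrite big1// => j _; rewrite mul0r.
rewrite -(sum_Pairs_sym (fun i j => (i \in D)%:R * w i j)).
rewrite big_mkcondr /= ler_sum// => e _; case: ifP => [|_]; last first.
  by rewrite addr_ge0 ?mulr_ge0.
rewrite (wsym e.2) -mulrDl => /pred0Pn[i /= /andP[iD]].
rewrite !inE => /orP[] /eqP ei; rewrite ei in iD; rewrite iD ler_peMl//.
  by rewrite lerDl.
by rewrite lerDr.
Qed.

Variables (K H : R).
Hypothesis m_ge0 : forall i j k, 0 <= m i j k.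
Hypothesis m_swap12 : forall i j k, m i j k = m j i k.
Hypothesis m_swap23 : forall i j k, m i j k = m i k j.
Hypothesis m_le_y : forall i j k, m i j k <= y i j.
Hypothesis K_ge0 : 0 <= K.
Hypothesis yy_le : forall i j k, distinct3 i j k ->
  y i j * y i k <= K * m i j k * (y i j + y i k).
Hypothesis h_le : h%:R <= H.

Let H_ge0 : 0 <= H. Proof. exact: le_trans h_le. Qed.

(** The unit in which all errors of a step and the drift of the correctors are
    measured: [y] will be the inverse distance of two walkers and [m] the
    inverse size of the triangle of three walkers. *)
Definition triple_energy := sum3 (fun i j k => m i j k * y i j).
Local Notation T := triple_energy.

Lemma triple_energy_ge0 : 0 <= T.
Proof. by apply: sum3_ge0 => i j k _; rewrite mulr_ge0. Qed.

Lemma sum3_yy_le : sum3 (fun i j k => y i j * y i k) <= 2 * K * T.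
Proof.
have -> : 2 * K * T = sum3 (fun i j k => K * m i j k * (y i j + y i k)).
  transitivity (sum3 (fun i j k => K * (m i j k * y i j) + K * (m i j k * y i k))).
    rewrite sum3D !sum3Z [X in _ = _ + K * X]sum3_swap23.
    rewrite [X in _ = _ + K * X](_ : _ = T); first by rewrite -/T; ring.
    by congr sum3; apply/funext => i; apply/funext => j; apply/funext => k;
      rewrite m_swap23.
  by congr sum3; apply/funext => i; apply/funext => j; apply/funext => k; ring.
exact: ler_sum3.
Qed.

(** Two adjacent pairs span a triple, and a product of two of its inverse
    distances is at most a constant times their sum times the inverse size of
    the triangle. *)
Lemma sum_adjacent_le :
  \sum_(e in Pairs h)
     \sum_(e' in Pairs h | (e' != e) && ~~ [disjoint pair_set e & pair_set e'])
        y e.1 e.2 * y e'.1 e'.2 <= 2 * K * T.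
Proof.
apply: le_trans sum3_yy_le.
pose G p q := \sum_(l | distinct3 p q l) y p q * y p l.
rewrite [leRHS](_ : _ = \sum_p \sum_(q | p != q) G p q); last first.
  apply: eq_bigr => p _; rewrite [RHS]big_mkcond; apply: eq_bigr => q _.
  by case: ifP => // pq; rewrite big_pred0// => l; rewrite /distinct3 pq.
rewrite -(sum_Pairs_sym G); apply: ler_sum => -[p q]; rewrite inE /= => pq.
pose w i j := if [|| (i == p) && (j == q) | (i == q) && (j == p)] then 0 else y i j.
have w0 i j : 0 <= w i j by rewrite /w; case: ifP.
have wsym i j : w i j = w j i.
  rewrite /w (y_sym j) [(j == p) && _]andbC [(j == q) && _]andbC orbC.
  by [].
have neq_pq : p != q by rewrite neq_ltn pq.
rewrite -mulr_sumr.
have -> : G p q + G q p = y p q * (\sum_(i in pair_set (p, q)) \sum_(j | i != j) w i j).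
  rewrite /pair_set /= big_setU1 ?inE//= big_set1 mulrDr; congr (_ + _).
    rewrite /G -mulr_sumr; congr (_ * _).
    rewrite big_mkcond [RHS]big_mkcond; apply: eq_bigr => l _.
    rewrite /distinct3 neq_pq /w eqxx (negbTE neq_pq) /= orbF.
    by rewrite [q == l]eq_sym; case: (l == q); rewrite ?andbF ?andbT//; case: ifP.
  rewrite /G (y_sym q p) -mulr_sumr; congr (_ * _).
  rewrite big_mkcond [RHS]big_mkcond; apply: eq_bigr => l _.
  rewrite /distinct3 [q == p]eq_sym neq_pq /w eqxx [q == p]eq_sym (negbTE neq_pq) /=.
  by rewrite [p == l]eq_sym; case: (l == p); rewrite ?andbF ?andbT//; case: ifP.
rewrite ler_wpM2l//; apply: le_trans (sum_touching _ w0 wsym).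
rewrite big_mkcondr [leRHS]big_mkcondr /=; apply: ler_sum => -[i j].
rewrite inE /= => ij; case: (disjoint _ _); rewrite ?andbF ?andbT //=.
rewrite /w xpair_eqE; case: (boolP ((i == p) && (j == q))) => //= _.
case: (boolP ((i == q) && (j == p))) => //= /andP[/eqP ip /eqP jq].
by move: ij; rewrite ip jq ltnNge ltnW.
Qed.

(** A pair touching a triple either lies in it or joins one of its points to a
    fourth point; in the second case the inverse size of the triangle is at
    most the inverse distance of an edge adjacent to the pair, and the free
    third point costs a factor [H]. *)
Lemma sum3_m_touching_le :
  sum3 (fun i j k => m i j k *
    \sum_(e in Pairs h | ~~ [disjoint [set i; j; k]%SET & pair_set e]) y e.1 e.2)
  <= 6 * (1 + H * K) * T.
Proof.
pose Y i := \sum_(l | i != l) y i l.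
have mY : sum3 (fun i j k => m i j k * Y i) <= 2 * (1 + H * K) * T.
  apply: (@le_trans _ _ (sum3 (fun i j k => m i j k * y i j +
      (m i j k * y i k + \sum_(l | distinct3 i j l) y i j * y i l)))).
    apply: ler_sum3 => i j k /and3P[ij ik jk].
    rewrite /Y (bigD1 j)//= (bigD1 k) /=; last by rewrite ik eq_sym.
    rewrite !mulrDr !lerD2l -mulr_sumr big_mkcond [X in _ <= _ * X]big_mkcond /=.
    rewrite ler_pM// ?sumr_ge0// => [l _|]; first by case: ifP.
    apply: ler_sum => l _; rewrite /distinct3 ij /= [j == l]eq_sym.
    by case: (i != l) => //=; case: (l != j) => //=; case: (l != k).
  rewrite !sum3D -/T [X in _ + (X + _)](_ : _ = T); last first.
    rewrite sum3_swap23; congr sum3; apply/funext => i; apply/funext => j.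
    by apply/funext => k; rewrite m_swap23.
  suff : sum3 (fun i j _ => \sum_(l | distinct3 i j l) y i j * y i l) <=
      H * (2 * K * T) by lra.
  apply: (@le_trans _ _ (H * sum3 (fun i j k => y i j * y i k))); last first.
    by rewrite ler_wpM2l// sum3_yy_le.
  rewrite /sum3 mulr_sumr; apply: ler_sum => i _.
  rewrite mulr_sumr; apply: ler_sum => j _.
  have s0 : 0 <= \sum_(l | distinct3 i j l) y i j * y i l.
    by apply: sumr_ge0 => l _; rewrite mulr_ge0.
  rewrite sumr_const -[X in X <= _]mulr_natl ler_wpM2r//.
  apply: le_trans h_le; rewrite ler_nat; apply: leq_trans (max_card _) _.
  by rewrite card_ord.
apply: (@le_trans _ _ (sum3 (fun i j k => m i j k * Y i +
    (m i j k * Y j + m i j k * Y k)))).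
  apply: ler_sum3 => i j k /and3P[ij ik jk]; rewrite -!mulrDr ler_wpM2l//.
  apply: le_trans (sum_touching _ y_ge0 y_sym) _.
  rewrite -finset.setUA big_setU1/=; last by rewrite !inE negb_or ij.
  by rewrite big_setU1 ?inE//= big_set1.
rewrite !sum3D.
have e2 : sum3 (fun i j k => m i j k * Y j) = sum3 (fun i j k => m i j k * Y i).
  rewrite sum3_swap12; congr sum3; apply/funext => i; apply/funext => j.
  by apply/funext => k; rewrite m_swap12.
have e3 : sum3 (fun i j k => m i j k * Y k) = sum3 (fun i j k => m i j k * Y i).
  rewrite sum3_swap23 -e2; congr sum3; apply/funext => i; apply/funext => j.
  by apply/funext => k; rewrite m_swap23.
rewrite e2 e3; lra.
Qed.

End OneStep.

(** * The one step estimate for pair factors and triple correctors *)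

Lemma expR_le_quadratic (R : realType) (x : R) :
  x <= 1 / 2 -> expR x <= 1 + x + 2 * x ^+ 2.
Proof.
move=> x12; have ex : 1 - x <= expR (- x) by rewrite expR_ge1Dx.
have x1 : 0 < 1 - x by lra.
have : (expR (- x))^-1 <= (1 - x)^-1 by rewrite lef_pV2// posrE// expR_gt0.
rewrite expRN invrK => /le_trans; apply.
rewrite -div1r ler_pdivrMr//.
have -> : (1 + x + 2 * x ^+ 2) * (1 - x) = 1 + x ^+ 2 * (1 - 2 * x) by ring.
by rewrite lerDl mulr_ge0 ?sqr_ge0//; lra.
Qed.

Section OneStepBound.
Variables (R : realType) (h : nat) (B : finType).
Hypothesis B_gt0 : (0 < #|B|)%N.
Variables (y : 'I_h -> 'I_h -> R) (m : 'I_h -> 'I_h -> 'I_h -> R) (K H : R).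
Hypothesis y_ge0 : forall i j, 0 <= y i j.
Hypothesis y_le1 : forall i j, y i j <= 1.
Hypothesis y_sym : forall i j, y i j = y j i.
Hypothesis m_ge0 : forall i j k, 0 <= m i j k.
Hypothesis m_swap12 : forall i j k, m i j k = m j i k.
Hypothesis m_swap23 : forall i j k, m i j k = m i k j.
Hypothesis m_le_y : forall i j k, m i j k <= y i j.
Hypothesis K_ge0 : 0 <= K.
Hypothesis yy_le : forall i j k, distinct3 i j k ->
  y i j * y i k <= K * m i j k * (y i j + y i k).
Hypothesis h_le : h%:R <= H.
Variables (x : 'I_h * 'I_h -> {ffun 'I_h -> B} -> R)
  (d : 'I_h -> 'I_h -> 'I_h -> {ffun 'I_h -> B} -> R) (eps D c eta : R).
Hypothesis x_dep : forall e, e \in Pairs h -> depends_on (pair_set e) (x e).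
Hypothesis x_mean : forall e, e \in Pairs h -> mean (x e) = 0.
Hypothesis x_le : forall e a, e \in Pairs h -> `|x e a| <= eps * y e.1 e.2.
Hypothesis d_dep : forall i j k, distinct3 i j k ->
  depends_on [set i; j; k]%SET (d i j k).
Hypothesis d_le : forall i j k a, distinct3 i j k -> `|d i j k a| <= D * m i j k.
Hypothesis d_mean : forall i j k, distinct3 i j k ->
  mean (d i j k) <= - c * (m i j k * y i j).
Hypothesis eps_ge0 : 0 <= eps.
Hypothesis D_ge0 : 0 <= D.
Hypothesis c_gt0 : 0 < c.
Hypothesis etaE : eta = 32 * K * eps ^+ 2 / c.
Hypothesis small1 : eps * H ^+ 2 <= 1 / 4.
Hypothesis small2 : eta * D * H ^+ 3 <= 1 / 2.
Hypothesis small3 : 24 * D * eps * (1 + H * K) + 4 * eta * D ^+ 2 * H ^+ 3 <= c / 4.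

Let H_ge0 : 0 <= H. Proof. exact: le_trans h_le. Qed.
Let A_gt0 : (0 < #|{ffun 'I_h -> B}|)%N.
Proof. by rewrite card_ffun expn_gt0 B_gt0. Qed.
Let eta_ge0 : 0 <= eta.
Proof. by rewrite etaE !mulr_ge0// ?sqr_ge0// invr_ge0 ltW. Qed.

Local Notation T := (triple_energy y m).
Let T_ge0 : 0 <= T. Proof. exact: triple_energy_ge0. Qed.

Let x' e a := if e \in Pairs h then x e a else 0.
Let eps' e := eps * y e.1 e.2.
Let x'_dep e : depends_on (pair_set e) (x' e).
Proof.
rewrite /x'; have [eP|_] := boolP (e \in Pairs h); first exact: x_dep.
by move=> a b _.
Qed.
Let x'_le e a : `|x' e a| <= eps' e.
Proof. by rewrite /x'; case: ifP => [/x_le//|_]; rewrite normr0 mulr_ge0. Qed.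
Let x'_mean e : mean (x' e) = 0.
Proof.
rewrite /x'; have [eP|_] := boolP (e \in Pairs h); first exact: x_mean.
exact: mean_cst.
Qed.

Let prodE a : \prod_(e in Pairs h) (1 + x e a) = \prod_(e <- enum (Pairs h)) (1 + x' e a).
Proof. by rewrite big_enum /=; apply: eq_bigr => e eP; rewrite /x' eP. Qed.

Let eps_sum : \sum_(e <- enum (Pairs h)) eps' e <= 1 / 4.
Proof.
apply: le_trans small1; rewrite -mulr_sumr ler_wpM2l//.
rewrite big_enum /=; apply: (@le_trans _ _ (\sum_(e : 'I_h * 'I_h) 1)).
  by rewrite big_mkcond ler_sum// => e _; case: ifP.
rewrite sumr_const card_prod card_ord natrM -expr2.
by rewrite ler_pXn2r// nnegrE.
Qed.

Let mean_prod_le : mean (fun a => \prod_(e in Pairs h) (1 + x e a)) <=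
  1 + 8 * K * eps ^+ 2 * T.
Proof.
under eq_mean do rewrite prodE.
apply: (le_trans (mean_prod_centered B_gt0 x'_dep x'_le (enum_uniq _) x'_mean eps_sum)).
rewrite lerD2l big_enum /=.
have -> : 8 * K * eps ^+ 2 * T = 4 * (eps ^+ 2 * (2 * K * T)) by ring.
rewrite ler_wpM2l//.
apply: (le_trans _ (ler_wpM2l (sqr_ge0 eps)
   (sum_adjacent_le y_ge0 y_sym m_swap23 yy_le))).
rewrite mulr_sumr ler_sum// => e _; rewrite big_enum_cond mulr_sumr ler_sum// => e' _.
by rewrite /eps' le_eqVlt; apply/orP; left; apply/eqP; ring.
Qed.

Let prod_ge_half (P : pred ('I_h * 'I_h)) a :
  1 / 2 <= \prod_(e <- enum (Pairs h) | P e) (1 + x' e a) <= 2.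
Proof.
have h1 : `|\prod_(e <- enum (Pairs h) | P e) (1 + x' e a) - 1|
    <= 2 * \sum_(e <- enum (Pairs h) | P e) eps' e.
  exact: prod_near1.
have h2 : \sum_(e <- enum (Pairs h) | P e) eps' e <= 1 / 4.
  apply: le_trans eps_sum; rewrite [leRHS](bigID P) /= lerDl sumr_ge0// => e _.
  by rewrite mulr_ge0.
move: h1; rewrite ler_norml => /andP[h3 h4]; apply/andP; split; lra.
Qed.

Let mean_d_prod_le i j k : distinct3 i j k ->
  mean (fun a => d i j k a * \prod_(e in Pairs h) (1 + x e a)) <=
  - c / 2 * (m i j k * y i j) + 4 * D * eps * (m i j k *
    \sum_(e in Pairs h | ~~ [disjoint [set i; j; k]%SET & pair_set e]) y e.1 e.2).
Proof.
move=> ijk; under eq_mean do rewrite prodE.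
have hm := mean_mul_prod B_gt0 x'_dep x'_le (d_dep ijk)
  (fun a => d_le a ijk) eps_sum.
apply: (le_trans hm).
apply: lerD; last first.
  rewrite big_enum_cond /= -mulr_sumr le_eqVlt; apply/orP; left; apply/eqP.
  by rewrite /touches; ring.
apply: (@le_trans _ _ (- c * (m i j k * y i j) * (1 / 2))); last by lra.
have p12 : 1 / 2 <= mean (fun a => \prod_(e <- enum (Pairs h) |
    ~~ touches (@pair_set h) [set i; j; k]%SET e) (1 + x' e a)).
  rewrite -[leLHS](mean_cst A_gt0); apply: ler_mean => // a.
  by have /andP[] := prod_ge_half (fun e => ~~ touches (@pair_set h) [set i; j; k]%SET e) a.
apply: (@le_trans _ _ (- c * (m i j k * y i j) * mean (fun a => \prod_(e <- enum (Pairs h) |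
    ~~ touches (@pair_set h) [set i; j; k]%SET e) (1 + x' e a)))).
  by rewrite ler_wpM2r ?d_mean//; lra.
by rewrite ler_wnM2l// mulNr oppr_le0 !mulr_ge0// ltW.
Qed.

Hypothesis x_ge : forall e a, e \in Pairs h -> 0 <= 1 + x e a.

(** The excess of the mean of the correlated product over 1 is of order
    [eps ^+ 2] times the energy; the drift of the triple corrector, weighted by
    [eta], is of the same order and negative. *)
Lemma one_step_le1 :
  mean (fun a => (\prod_(e in Pairs h) (1 + x e a)) *
                 expR (eta * sum3 (fun i j k => d i j k a))) <= 1.
Proof.
pose S a := sum3 (fun i j k => d i j k a).
pose P a := \prod_(e in Pairs h) (1 + x e a).
have P0 a : 0 <= P a by apply: prodr_ge0 => e /x_ge.
have P2 a : P a <= 2.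
  by rewrite /P prodE; have /andP[] := prod_ge_half xpredT a.
have h3H : (#|'I_h|%:R : R) ^+ 3 <= H ^+ 3 by rewrite card_ord ler_pXn2r// nnegrE.
have Sle a : eta * S a <= 1 / 2.
  apply: le_trans small2; rewrite -mulrA ler_wpM2l// /S.
  rewrite mulrC; apply: (@le_trans _ _ (#|'I_h|%:R ^+ 3 * D)); last first.
    by rewrite ler_wpM2r.
  apply: sum3_le_card => // i j k ijk; apply: (le_trans (ler_norm _)).
  apply: (le_trans (d_le a ijk)); rewrite ler_piMr//.
  by apply: le_trans (m_le_y i j k) _.
have S2 a : S a ^+ 2 <= H ^+ 3 * (D ^+ 2 * T).
  apply: (@le_trans _ _ ((sum3 (fun i j k => D * m i j k)) ^+ 2)).
    rewrite -real_normK ?num_real// ler_pXn2r ?nnegrE//; last first.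
      by apply: sum3_ge0 => *; rewrite mulr_ge0.
    apply: (le_trans (ler_norm_sum _ _ _)); apply: ler_sum => i _.
    apply: (le_trans (ler_norm_sum _ _ _)); apply: ler_sum => j _.
    apply: (le_trans (ler_norm_sum _ _ _)); apply: ler_sum => k ijk.
    exact: d_le.
  apply: (le_trans (sum3_sqr_le _)); first by move=> *; rewrite mulr_ge0.
  rewrite ler_pM// ?exprn_ge0// ?sum3_ge0 // => [*|]; first exact: sqr_ge0.
  rewrite /triple_energy -sum3Z; apply: ler_sum3 => i j k _.
  by rewrite exprMn ler_wpM2l ?sqr_ge0// expr2 ler_wpM2l.
have mE : mean (fun a => P a * expR (eta * S a)) <=
    mean P + (eta * mean (fun a => S a * P a) + 4 * eta ^+ 2 * (H ^+ 3 * (D ^+ 2 * T))).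
  rewrite -[X in _ + (_ + X)](mean_cst A_gt0) -meanZ -!meanD; apply: ler_mean => // a.
  apply: (le_trans (ler_wpM2l (P0 a) (expR_le_quadratic (Sle a)))).
  have : P a * (S a ^+ 2) <= 2 * (H ^+ 3 * (D ^+ 2 * T)).
    by rewrite ler_pM// sqr_ge0.
  move=> /(ler_wpM2l (sqr_ge0 eta)) hh.
  have -> : P a * (1 + eta * S a + 2 * (eta * S a) ^+ 2) =
     P a + eta * (S a * P a) + 2 * (eta ^+ 2 * (P a * S a ^+ 2)) by ring.
  lra.
apply: (le_trans mE).
have SP : mean (fun a => S a * P a) <= - c / 2 * T + 4 * D * eps * (6 * (1 + H * K) * T).
  rewrite (_ : (fun a => S a * P a) = fun a => sum3 (fun i j k => d i j k a * P a)); last first.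
    apply/funext => a; rewrite mulrC -sum3Z; congr sum3.
    by apply/funext => i; apply/funext => j; apply/funext => k; rewrite mulrC.
  rewrite mean_sum3.
  apply: (le_trans (ler_sum3 mean_d_prod_le)).
  rewrite sum3D !sum3Z lerD2l ler_wpM2l ?mulr_ge0//.
  exact: sum3_m_touching_le.
apply: (le_trans (lerD mean_prod_le (lerD (ler_wpM2l eta_ge0 SP) (lexx _)))).
have e8 : 8 * K * eps ^+ 2 = c * eta / 4 by rewrite etaE; field; rewrite gt_eqF.
rewrite e8.
have := ler_wpM2r T_ge0 (ler_wpM2l eta_ge0 small3).
lra.
Qed.

End OneStepBound.

(** * The lazy walk followed by a coordinate of a difference of two walks *)

Section LazyWalk.
Variable R : realType.

(** The law at time [m] of a coordinate of the difference of two walks: each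
    step is [1], [0] or [-1] with probabilities 1/4, 1/2, 1/4. *)
Fixpoint lazy_prob (m : nat) (k : int) : R :=
  if m is m'.+1 then
    4^-1 * lazy_prob m' (k - 1) + 2^-1 * lazy_prob m' k + 4^-1 * lazy_prob m' (k + 1)
  else (k == 0)%:R.
Local Notation beta := lazy_prob.

Lemma lazy_prob_ge0 m k : 0 <= beta m k.
Proof. by elim: m k => [|m IH] k //=; rewrite !addr_ge0 ?mulr_ge0. Qed.

Lemma lazy_probN m k : beta m (- k) = beta m k.
Proof.
elim: m k => [|m IH] k /=; first by rewrite oppr_eq0.
rewrite -(IH (- k - 1)) -(IH (- k + 1)) (IH k) !opprD !opprK; ring.
Qed.

(** The probability is 4^-m times the binomial coefficient of 2m over m + k.
    The ratio of neighbours, in this form, holds for all integers [k]. *)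
Lemma lazy_prob_ratio m (k : int) :
  (m%:R + k%:~R + 1) * beta m (k + 1) = (m%:R - k%:~R) * beta m k.
Proof.
elim: m k => [|m IH] k.
  rewrite /= add0r sub0r; have [->|k0] := eqVneq k 0.
    by rewrite add0r /= mulr0z oppr0 mul0r mulr0.
  rewrite mulr0; have [k1|_] := eqVneq (k + 1) 0; last by rewrite mulr0.
  have e : k%:~R + 1 = (k + 1)%:~R :> R by rewrite intrD.
  by rewrite e k1 mul0r.
have h0 := IH k.
have h1 := IH (k + 1).
have hm := IH (k - 1).
rewrite subrK in hm.
rewrite /= -natr1 addrK.
move: h0 h1 hm; rewrite !intrD !intrN.
set b0 := beta m k; set b1 := beta m (k + 1); set bm := beta m (k - 1).
set b2 := beta m (k + 1 + 1); set x := k%:~R; set M := m%:R.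
move=> h0 h1 hm.
have -> : (M + 1 + x + 1) * (4^-1 * b0 + 2^-1 * b1 + 4^-1 * b2) =
  4^-1 * ((M + x + 2) * b0 + 2 * (M + x + 2) * b1 + (M + (x + 1) + 1) * b2).
  by field.
have -> : (M + 1 - x) * (4^-1 * bm + 2^-1 * b0 + 4^-1 * b1) =
  4^-1 * ((M - (x - 1)) * bm + 2 * (M + 1 - x) * b0 + (M + 1 - x) * b1) by field.
rewrite h1 -hm; congr (_ * _); apply/eqP; rewrite -subr_eq0; apply/eqP.
have -> : (M + x + 2) * b0 + 2 * (M + x + 2) * b1 + (M - (x + 1)) * b1 -
  ((M + (x - 1) + 1) * b0 + 2 * (M + 1 - x) * b0 + (M + 1 - x) * b1) =
  2 * ((M + x + 1) * b1 - (M - x) * b0) by ring.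
by rewrite h0 subrr mulr0.
Qed.

Lemma lazy_prob0S m : beta m.+1 0 = beta m 0 * ((2 * m%:R + 1) / (2 * m%:R + 2)).
Proof.
have := lazy_prob_ratio m 0.
rewrite /= sub0r lazy_probN !add0r !addr0 subr0 => h.
have m1 : m%:R + 1 != 0 :> R by rewrite natr1 pnatr_eq0.
rewrite (_ : beta m 1 = m%:R * beta m 0 / (m%:R + 1)); last first.
  by rewrite -h; field.
by field; rewrite (_ : _ + 2 = 2 * (m%:R + 1)) ?mulf_neq0//; ring.
Qed.

Lemma lazy_prob0_sqr_le m : beta m 0 ^+ 2 * (2 * m%:R + 1) <= 1.
Proof.
elim: m => [|m IH]; first by rewrite /= expr1n mulr0 add0r mulr1.
apply: le_trans IH; rewrite lazy_prob0S exprMn -mulrA ler_wpM2l ?sqr_ge0//.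
have m0 : 0 <= m%:R :> R by [].
rewrite -natr1 expr_div_n mulrAC ler_pdivrMr ?exprn_gt0//; last by lra.
Qed.

Lemma lazy_prob0_le m : beta m 0 <= (Num.sqrt (m%:R + 1))^-1.
Proof.
have m0 : 0 <= m%:R :> R by [].
have m1 : 0 < Num.sqrt (m%:R + 1 : R) by rewrite sqrtr_gt0; lra.
rewrite -div1r ler_pdivlMr// -(ler_pXn2r (_ : 0 < 2)%N) ?nnegrE//.
  rewrite exprMn sqr_sqrtr ?addr_ge0// expr1n.
  apply: le_trans (lazy_prob0_sqr_le m).
  by rewrite ler_wpM2l ?sqr_ge0//; lra.
by rewrite mulr_ge0 ?lazy_prob_ge0 ?sqrtr_ge0.
Qed.

(** The decay factor of the lazy walk at time [m]: the Gaussian is replaced by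
    a power of a rational function, which can be checked term by term against
    the exact ratios of the probabilities. *)
Definition decay (m : nat) (k : int) : R :=
  (2 * (m%:R + 1)) / (2 * (m%:R + 1) + k%:~R ^+ 2).

Let mge0 (m : nat) : 0 <= m%:R :> R. Proof. by []. Qed.

Let den_gt0 (m : nat) (k : int) : 0 < 2 * (m%:R + 1) + k%:~R ^+ 2 :> R.
Proof. by have := mge0 m; have := sqr_ge0 (k%:~R : R); lra. Qed.

Lemma decay_gt0 m k : 0 < decay m k.
Proof. by rewrite divr_gt0 ?den_gt0//; have := mge0 m; lra. Qed.

Lemma decay_le1 m k : decay m k <= 1.
Proof.
by rewrite ler_pdivrMr ?den_gt0// mul1r lerDl sqr_ge0.
Qed.

Lemma decayN m k : decay m (- k) = decay m k.
Proof. by rewrite /decay intrN sqrrN. Qed.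

Lemma decay_near m k k' : `|k' - k| <= 1 -> decay m k' <= 2 * decay m k.
Proof.
move=> kk'; rewrite /decay mulrA ler_pdivrMr// mulrAC ler_pdivlMr//.
have : `|k'%:~R - k%:~R : R| <= 1.
  by rewrite -intrB -intr_norm (_ : 1 = 1%:~R)// ler_int.
have := mge0 m; move: (k%:~R : R) (k'%:~R : R) (m%:R : R) => u v M M0.
rewrite ler_norml => /andP[h1 h2].
have hu : u ^+ 2 <= 2 * v ^+ 2 + 2.
  have h3 : 0 <= (1 - (v - u)) * (1 + (v - u)) by rewrite mulr_ge0//; lra.
  by have := sqr_ge0 (2 * v - u); lra.
have : 0 <= (2 * (M + 1)) * (2 * (M + 1) + 2 * v ^+ 2 - u ^+ 2).
  by rewrite mulr_ge0//; lra.
lra.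
Qed.

(** The square leaves one factor of decay after the other has paid for the
    factor k / m that the gradient produces. *)
Lemma lazy_prob_le_nat m (k : nat) :
  beta m k%:Z <= decay m k%:Z ^+ 2 * (Num.sqrt (m%:R + 1))^-1.
Proof.
apply: (@le_trans _ _ (decay m k%:Z ^+ 2 * beta m 0)); last first.
  by rewrite ler_wpM2l ?sqr_ge0 ?lazy_prob0_le.
elim: k => [|k IH].
  suff -> : decay m 0%:Z = 1 by rewrite expr1n mul1r.
  by rewrite /decay mulr0z expr0n addr0 divff// lt0r_neq0//; have := mge0 m; lra.
have k0 : 0 <= k%:R :> R by [].
have m0 := mge0 m.
have mk0 : 0 < m%:R + k%:R + 1 :> R by lra.
have hr := lazy_prob_ratio m k%:Z.
rewrite -[k.+1]addn1 PoszD.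
rewrite -(ler_pM2l mk0) hr -[k%:Z%:~R]/(k%:R : R).
have b0 := lazy_prob_ge0 m k%:Z.
apply: (@le_trans _ _ ((m%:R + k%:R + 1) *
    (decay m (k%:Z + 1) ^+ 2 / decay m k%:Z ^+ 2) * beta m k%:Z)).
  rewrite ler_wpM2r//.
  have -> : decay m (k%:Z + 1) ^+ 2 / decay m k%:Z ^+ 2 =
      ((2 * (m%:R + 1) + k%:R ^+ 2) / (2 * (m%:R + 1) + (k%:R + 1) ^+ 2)) ^+ 2.
    rewrite -expr_div_n /decay; congr (_ ^+ 2).
    have := den_gt0 m k%:Z; have := den_gt0 m (k%:Z + 1); rewrite intrD.
    rewrite -[k%:Z%:~R]/(k%:R : R) mulr1z.
    have : 0 < m%:R + 1 :> R by lra.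
    move: (m%:R : R) (k%:R : R) => M u h1 h2 h3.
    by field; rewrite !lt0r_neq0//=.
  have d1 : 0 < 2 * (m%:R + 1) + (k%:R + 1) ^+ 2 :> R.
    by have := sqr_ge0 (k%:R + 1 : R); lra.
  rewrite expr_div_n mulrA ler_pdivlMr ?exprn_gt0//.
  move: (m%:R : R) (k%:R : R) m0 k0 => M u M0 u0 /= in d1 mk0 *.
  set a := 2 * (M + 1) + (u + 1) ^+ 2.
  have -> : 2 * (M + 1) + u ^+ 2 = a - (2 * u + 1) by rewrite /a; ring.
  have -> : M - u = M + u + 1 - (2 * u + 1) by ring.
  (* (1 - v/a)^2 >= 1 - 2 v / a, and 2 (M + u + 1) <= a *)
  have ha : 2 * (M + u + 1) <= a by rewrite /a; have := sqr_ge0 u; nra.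
  have -> : (M + u + 1) * (a - (2 * u + 1)) ^+ 2 =
    (M + u + 1 - (2 * u + 1)) * a ^+ 2 + (2 * u + 1) * a * (a - 2 * (M + u + 1))
    + (M + u + 1) * (2 * u + 1) ^+ 2 by ring.
  rewrite -[leRHS]addrA lerDl; apply: addr_ge0; apply: mulr_ge0.
  - by apply: mulr_ge0; lra.
  - by rewrite subr_ge0.
  - by lra.
  - exact: sqr_ge0.
rewrite -mulrA ler_pM2l// -mulrA ler_wpM2l ?sqr_ge0//.
by rewrite [leLHS]mulrC ler_pdivrMr ?exprn_gt0 ?decay_gt0// [leRHS]mulrC.
Qed.

Lemma lazy_prob_le m k : beta m k <= decay m k * (Num.sqrt (m%:R + 1))^-1.
Proof.
suff h (n : nat) : beta m n%:Z <= decay m n%:Z * (Num.sqrt (m%:R + 1))^-1.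
  by case: k => n; [exact: h|rewrite NegzE -lazy_probN -decayN opprK; exact: h].
apply: (le_trans (lazy_prob_le_nat m n)).
rewrite ler_wpM2r ?invr_ge0 ?sqrtr_ge0// expr2 ler_piMr ?decay_le1//.
exact/ltW/decay_gt0.
Qed.

Lemma lazy_prob_grad_nat m (n : nat) :
  `|beta m (n%:Z + 1) - beta m n%:Z| <= 3 * decay m n%:Z / (m%:R + 1).
Proof.
have n0 : 0 <= n%:R :> R by [].
have m0 := mge0 m.
have mn0 : 0 < m%:R + n%:R + 1 :> R by lra.
have m1 : 0 < m%:R + 1 :> R by lra.
have e : beta m (n%:Z + 1) - beta m n%:Z =
    - (beta m n%:Z * (2 * n%:R + 1) / (m%:R + n%:R + 1)).
  apply: (mulfI (lt0r_neq0 mn0)).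
  rewrite mulrBr -[X in _ + X + 1]/(n%:Z%:~R) lazy_prob_ratio.
  by rewrite -[n%:Z%:~R]/(n%:R); field; exact: lt0r_neq0.
rewrite e normrN ger0_norm; last first.
  by rewrite !mulr_ge0 ?lazy_prob_ge0 ?invr_ge0 ?ltW//; lra.
have s0 : 0 < Num.sqrt (m%:R + 1 : R) by rewrite sqrtr_gt0.
have ss : Num.sqrt (m%:R + 1 : R) ^+ 2 = m%:R + 1 by rewrite sqr_sqrtr// ltW.
apply: (@le_trans _ _ (beta m n%:Z * (2 * n%:R + 1) / (m%:R + 1))).
  rewrite ler_wpM2l ?mulr_ge0 ?lazy_prob_ge0//.
  by rewrite lef_pV2 ?posrE//; lra.
rewrite ler_wpM2r ?invr_ge0 ?(ltW m1)//.
set s := Num.sqrt _ in s0 ss.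
have s1 : 1 <= s by rewrite -[leLHS]sqrtr1 ler_wsqrtr; lra.
have h2 : decay m n%:Z * (2 * n%:R + 1) <= 3 * s.
  rewrite /decay mulrAC ler_pdivrMr// -[n%:Z%:~R]/(n%:R) -ss.
  move: (n%:R : R) n0 => u u0.
  (* the discriminant of 3 u^2 - 4 s u + 6 s^2 - 2 s is negative *)
  have : s * (2 * s * (2 * u + 1)) <= s * (3 * (2 * s ^+ 2 + u ^+ 2)).
    rewrite ler_pM2l//; have := sqr_ge0 (u - 2 / 3 * s); nra.
  by lra.
apply: (le_trans (ler_wpM2r _ (lazy_prob_le_nat m n))); first by lra.
rewrite -/s; set p := decay m n%:Z in h2 *.
have p0 : 0 <= p by rewrite ltW ?decay_gt0.
have -> : p ^+ 2 / s * (2 * n%:R + 1) = p * (p * (2 * n%:R + 1)) / s by ring.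
rewrite ler_pdivrMr//; apply: (le_trans (ler_wpM2l p0 h2)).
by rewrite le_eqVlt; apply/orP; left; apply/eqP; ring.
Qed.

Lemma lazy_prob_grad m (k k' : int) : `|k' - k| <= 1 ->
  `|beta m k' - beta m k| <= 6 * decay m k / (m%:R + 1).
Proof.
have m1 : 0 < m%:R + 1 :> R by have := mge0 m; lra.
have up (n : nat) k1 : (k1 == n%:Z) || (k1 == n%:Z + 1) ->
    `|beta m (n%:Z + 1) - beta m n%:Z| <= 6 * decay m k1 / (m%:R + 1).
  move=> hk; apply: (le_trans (lazy_prob_grad_nat m n)).
  rewrite ler_wpM2r ?invr_ge0 ?(ltW m1)//.
  have : decay m n%:Z <= 2 * decay m k1.
    apply: decay_near; case/orP: hk => /eqP ->; first by rewrite subrr.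
    by rewrite opprD addNKr normrN.
  lra.
have up' (n : nat) k1 : (k1 == n%:Z) || (k1 == n%:Z + 1) ->
    `|beta m n%:Z - beta m (n%:Z + 1)| <= 6 * decay m k1 / (m%:R + 1).
  by rewrite distrC; exact: up.
have main (j : int) k1 : (k1 == j) || (k1 == j + 1) ->
    `|beta m (j + 1) - beta m j| <= 6 * decay m k1 / (m%:R + 1).
  case: j => n; first exact: up.
  rewrite NegzE => hk.
  rewrite -(lazy_probN m (- _)) -(lazy_probN m (- _ + 1)) -(decayN m k1).
  rewrite opprK opprD opprK -addn1 PoszD addrK.
  apply: up'; case/orP: hk => /eqP ->.
    by rewrite opprK -addn1 PoszD eqxx orbT.
  by rewrite opprD opprK -addn1 PoszD addrK eqxx.
move=> hk.
have [|] : k' = k \/ (k' = k + 1 \/ k = k' + 1) by move: hk; lia.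
  by move=> ->; rewrite subrr normr0 !mulr_ge0 ?invr_ge0 ?ltW ?decay_gt0.
case=> [->|hk']; first by apply: main; rewrite eqxx.
by rewrite distrC {1}hk'; apply: main; rewrite hk' eqxx orbT.
Qed.

End LazyWalk.

(** * The truncated Green function of the difference walk *)

Section Green.
Variable R : realType.
Local Notation beta := (lazy_prob R).

Definition kernel (m : nat) (k l : int) : R := beta m k * beta m l.

(** The expected number of collisions within [n] steps. *)
Definition green (n : nat) (k l : int) : R := \sum_(1 <= m < n.+1) kernel m k l.

Lemma kernel_ge0 m k l : 0 <= kernel m k l.
Proof. by rewrite mulr_ge0 ?lazy_prob_ge0. Qed.

Lemma green_ge0 n k l : 0 <= green n k l.
Proof. by apply: sumr_ge0 => m _; exact: kernel_ge0. Qed.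

Lemma green0 k l : green 0 k l = 0.
Proof. by rewrite /green big_geq. Qed.

Lemma greenS n k l : green n.+1 k l = green n k l + kernel n.+1 k l.
Proof. by rewrite /green big_nat_recr. Qed.

Lemma green_le n n' k l : (n <= n')%N -> green n k l <= green n' k l.
Proof.
move=> /subnK <-; elim: (n' - n)%N => // j IH.
by rewrite addSn greenS (le_trans IH)// lerDl kernel_ge0.
Qed.

Definition step_diff (s t : bool) : int := (s : nat)%:Z - (t : nat)%:Z.

Lemma step_diff_le1 s t : `|step_diff s t| <= 1.
Proof. by case: s; case: t. Qed.

Lemma sum_bool2 (F : bool * bool -> R) :
  \sum_s F s = F (true, true) + F (true, false) + F (false, true) + F (false, false).
Proof.
rewrite (eq_bigr (fun s => F (s.1, s.2))); last by case.
by rewrite -(pair_bigA _ (fun s t => F (s, t))) /= !big_bool /= addrA.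
Qed.

Lemma kernelS m k l : kernel m.+1 k l = 16^-1 * \sum_(s : bool * bool) \sum_(t : bool * bool)
  kernel m (k + step_diff s.1 t.1) (l + step_diff s.2 t.2).
Proof.
rewrite !sum_bool2 /= /kernel /step_diff /=.
rewrite (_ : Posz 1 - Posz 1 = 0)// (_ : Posz 1 - Posz 0 = 1)//.
rewrite (_ : Posz 0 - Posz 1 = - 1)// (_ : Posz 0 - Posz 0 = 0)// !addr0.
by field.
Qed.

Lemma green_rec n k l : green n.+1 k l = 16^-1 * \sum_(s : bool * bool) \sum_(t : bool * bool)
  (((k + step_diff s.1 t.1 == 0) && (l + step_diff s.2 t.2 == 0))%:R +
   green n (k + step_diff s.1 t.1) (l + step_diff s.2 t.2)).
Proof.
rewrite /green big_add1 /= (eq_big_nat _ _ (fun i _ => kernelS i k l)) -mulr_sumr.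
congr (_ * _); rewrite exchange_big; apply: eq_bigr => s _.
rewrite exchange_big; apply: eq_bigr => t _ /=.
rewrite big_ltn//; congr (_ + _).
by rewrite /kernel /= -natrM mulnb.
Qed.

Definition sqnorm (k l : int) : R := k%:~R ^+ 2 + l%:~R ^+ 2.

Lemma sqnorm_ge0 k l : 0 <= sqnorm k l.
Proof. by rewrite addr_ge0 ?sqr_ge0. Qed.

Let mge0 (m : nat) : 0 <= m%:R :> R. Proof. by []. Qed.

Lemma decay_prod_le m k l :
  decay R m k * decay R m l <=
  2 * (m%:R + 1) / (m%:R + 1 + (sqnorm k l + 1)).
Proof.
have := mge0 m; have := sqr_ge0 (k%:~R : R); have := sqr_ge0 (l%:~R : R).
rewrite /decay /sqnorm; move: (m%:R : R) (k%:~R ^+ 2 : R) (l%:~R ^+ 2 : R).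
move=> M u v v0 u0 M0.
rewrite mulrACA -invfM ler_pdivrMr; last by rewrite mulr_gt0//; lra.
rewrite [leRHS]mulrAC ler_pdivlMr; last by lra.
have : 0 <= (M + 1) * (2 * u * v) by rewrite !mulr_ge0//; lra.
have : 0 <= (M + 1) * (4 * M * (M + 1)) by rewrite !mulr_ge0//; lra.
lra.
Qed.

Lemma kernel_grad m k l k' l' : `|k' - k| <= 1 -> `|l' - l| <= 1 ->
  `|kernel m k' l' - kernel m k l| <=
  36 / (Num.sqrt (m%:R + 1) * (m%:R + 1 + (sqnorm k l + 1))).
Proof.
move=> hk hl.
have m1 : 0 < m%:R + 1 :> R by have := mge0 m; lra.
set s : R := Num.sqrt (m%:R + 1); have s0 : 0 < s by rewrite sqrtr_gt0.
have -> : kernel m k' l' - kernel m k l =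
  (beta m k' - beta m k) * beta m l' + beta m k * (beta m l' - beta m l).
  by rewrite /kernel; ring.
have b1 := lazy_prob_grad R m hk.
have b2 := lazy_prob_grad R m hl.
have b3 := lazy_prob_le R m k.
have b4 : beta m l' <= 2 * decay R m l / s.
  apply: (le_trans (lazy_prob_le R m l')).
  by rewrite ler_wpM2r ?invr_ge0 ?sqrtr_ge0// decay_near.
have p0 := ltW (decay_gt0 R m k).
have p0' := ltW (decay_gt0 R m l).
apply: (le_trans (ler_normD _ _)); rewrite !normrM.
rewrite (ger0_norm (lazy_prob_ge0 R m l')) (ger0_norm (lazy_prob_ge0 R m k)).
have h1 := ler_pM (normr_ge0 _) (lazy_prob_ge0 R m l') b1 b4.
have h2 := ler_pM (lazy_prob_ge0 R m k) (normr_ge0 _) b3 b2.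
apply: (le_trans (lerD h1 h2)); rewrite -/s.
have -> : 6 * decay R m k / (m%:R + 1) * (2 * decay R m l / s) +
   decay R m k / s * (6 * decay R m l / (m%:R + 1)) =
   18 / ((m%:R + 1) * s) * (decay R m k * decay R m l).
  by field; rewrite !lt0r_neq0.
apply: (le_trans (ler_wpM2l _ (decay_prod_le m k l))).
  by rewrite divr_ge0// mulr_ge0// ltW.
have d0 : 0 < m%:R + 1 + (sqnorm k l + 1) by have := sqnorm_ge0 k l; lra.
by rewrite le_eqVlt; apply/orP; left; apply/eqP; field; rewrite !lt0r_neq0.
Qed.

Lemma kernel_le m k l : kernel m k l <= 2 / (m%:R + 1 + (sqnorm k l + 1)).
Proof.
have m1 : 0 < m%:R + 1 :> R by have := mge0 m; lra.
have d0 : 0 < m%:R + 1 + (sqnorm k l + 1) by have := sqnorm_ge0 k l; lra.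
set s : R := Num.sqrt (m%:R + 1).
have ss : s * s = m%:R + 1 by rewrite -expr2 sqr_sqrtr// ltW.
apply: (le_trans (ler_pM (lazy_prob_ge0 _ _ _) (lazy_prob_ge0 _ _ _)
  (lazy_prob_le R m k) (lazy_prob_le R m l))).
rewrite mulrACA -invfM -/s ss ler_pdivrMr//.
apply: (le_trans (decay_prod_le m k l)).
by rewrite mulrAC.
Qed.

(** A telescoping majorant: 1 / (p (p^2 + s^2)) integrates an arctangent in
    [p = sqrt m], and [p / (p + s)] is an algebraic substitute for it. *)
Lemma sum_sqrt_le (n : nat) (s : R) : 0 < s ->
  \sum_(1 <= m < n.+1) 1 / (Num.sqrt (m%:R + 1) * (m%:R + 1 + s ^+ 2)) <= 4 / s.
Proof.
move=> s0; pose g (m : nat) := Num.sqrt m%:R / (Num.sqrt m%:R + s).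
have g1 m : g m <= 1.
  by rewrite ler_pdivrMr ?ltr_wpDl ?sqrtr_ge0// mul1r lerDl ltW.
have gS m : 1 / (Num.sqrt (m%:R + 1) * (m%:R + 1 + s ^+ 2)) <= 4 / s * (g m.+1 - g m).
  rewrite /g -[m.+1%:R]natr1; have m0 := mge0 m.
  set p : R := Num.sqrt (m%:R + 1); set q : R := Num.sqrt m%:R.
  have p0 : 0 < p by rewrite sqrtr_gt0; lra.
  have q0 : 0 <= q by rewrite sqrtr_ge0.
  have pp : p ^+ 2 = m%:R + 1 by rewrite sqr_sqrtr//; lra.
  have qq : q ^+ 2 = m%:R by rewrite sqr_sqrtr.
  have qp : q <= p by rewrite ler_wsqrtr//; lra.
  have e : (p - q) * (p + q) = 1.
    by rewrite -subr_sqr pp qq; ring.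
  have pq : 1 <= 2 * p * (p - q).
    have : 0 <= (p - q) * (p - q) by apply: mulr_ge0; lra.
    by lra.
  rewrite -pp.
  have -> : 4 / s * (p / (p + s) - q / (q + s)) = 4 * (p - q) / ((p + s) * (q + s)).
    by field; rewrite !lt0r_neq0//; lra.
  rewrite ler_pdivrMr; last by rewrite mulr_gt0//; have := sqr_ge0 p; have := exprn_gt0 2 s0; lra.
  rewrite mulrAC ler_pdivlMr; last by rewrite mulr_gt0//; lra.
  rewrite mul1r.
  apply: (@le_trans _ _ ((p + s) * (p + s))).
    by rewrite ler_wpM2l//; lra.
  apply: (@le_trans _ _ (2 * (p ^+ 2 + s ^+ 2))).
    by have := sqr_ge0 (p - s); lra.
  have -> : 4 * (p - q) * (p * (p ^+ 2 + s ^+ 2)) =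
    2 * (p ^+ 2 + s ^+ 2) * (2 * p * (p - q)) by ring.
  by rewrite ler_peMr// mulr_ge0// addr_ge0// sqr_ge0.
have g0 m : 0 <= g m by rewrite divr_ge0 ?addr_ge0 ?sqrtr_ge0// ltW.
apply: (@le_trans _ _ (\sum_(1 <= m < n.+1) 4 / s * (g m.+1 - g m))).
  by apply: ler_sum => m _.
rewrite -mulr_sumr telescope_sumr// ler_piMr ?divr_ge0 ?(ltW s0)//.
by have := g1 n.+1; have := g0 1%N; lra.
Qed.

Lemma green_grad n k l k' l' : `|k' - k| <= 1 -> `|l' - l| <= 1 ->
  `|green n k' l' - green n k l| <= 144 / Num.sqrt (sqnorm k l + 1).
Proof.
move=> hk hl; have r0 := sqnorm_ge0 k l.
rewrite /green -sumrB; apply: (le_trans (ler_norm_sum _ _ _)).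
set s : R := Num.sqrt _; have s0 : 0 < s by rewrite sqrtr_gt0; lra.
have ss : sqnorm k l + 1 = s ^+ 2 by rewrite sqr_sqrtr//; lra.
apply: (@le_trans _ _ (\sum_(1 <= m < n.+1) 36 *
    (1 / (Num.sqrt (m%:R + 1) * (m%:R + 1 + s ^+ 2))))).
  by apply: ler_sum => m _; rewrite -ss mulrA mulr1; exact: kernel_grad.
rewrite -mulr_sumr; apply: (le_trans (ler_wpM2l _ (sum_sqrt_le n s0))) => //.
by rewrite le_eqVlt; apply/orP; left; apply/eqP; ring.
Qed.

(** Besides the gradient, the shorter time horizon costs one kernel, which is at
    most of the order of the inverse squared distance at all times. *)
Lemma green_step n k l k' l' : `|k' - k| <= 1 -> `|l' - l| <= 1 ->
  `|green n k' l' - green n.+1 k l| <= 146 / Num.sqrt (sqnorm k l + 1).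
Proof.
move=> hk hl; have r0 := sqnorm_ge0 k l.
rewrite greenS opprD addrA; apply: (le_trans (ler_normB _ _)).
rewrite (ger0_norm (kernel_ge0 _ _ _)).
have h1 := green_grad n hk hl.
suff h2 : kernel n.+1 k l <= 2 / Num.sqrt (sqnorm k l + 1) by lra.
apply: (le_trans (kernel_le n.+1 k l)).
rewrite ler_wpM2l// lef_pV2 ?posrE ?sqrtr_gt0; [|by have := mge0 n.+1; lra|by lra].
apply: (@le_trans _ _ (sqnorm k l + 1)); last by have := mge0 n.+1; lra.
rewrite -{2}(sqr_sqrtr (_ : 0 <= sqnorm k l + 1)); last by lra.
rewrite expr2 ler_peMr ?sqrtr_ge0//.
by rewrite -[leLHS]sqrtr1 ler_wsqrtr//; lra.
Qed.

End Green.

(** * The Wallis integrals and the size of the Green function at the origin *)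

Section Wallis.
Variable R : realType.

(** The reduction formula given by an integration by parts. *)
Fixpoint cos_primitive (n : nat) : R -> R :=
  match n with
  | 0 => id
  | m.+1 =>
    if m is n'.+1 then
      fun x => n'.+2%:R^-1 *: (cos x ^+ n'.+1 * sin x + n'.+1%:R *: cos_primitive n' x)
    else sin
  end.

Lemma is_derive_cos_primitive n (x : R) :
  is_derive x 1 (cos_primitive n) (cos x ^+ n).
Proof.
suff : is_derive x 1 (cos_primitive n) (cos x ^+ n) /\
  is_derive x 1 (cos_primitive n.+1) (cos x ^+ n.+1) by case.
elim: n => [|n [IH0 IH1]]; first by split; [exact: is_derive_id|exact: is_derive_sin].
split => //.
have h := @is_deriveZ _ _ _ _ n.+2%:R^-1 x 1 _ (is_deriveD
  (is_deriveM (is_deriveX n.+1 (is_derive_cos x)) (is_derive_sin x))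
  (is_deriveZ n.+1%:R IH0)).
match type of h with is_derive _ _ ?F _ => have fE : F = cos_primitive n.+2 end.
  apply/funext => y; by rewrite !fctE.
rewrite -fE; apply: (is_derive_eq h).
have n2 : n.+2%:R != 0 :> R by rewrite pnatr_eq0.
apply: (mulfI n2); rewrite -[X in _ * X = _]/(_ * _) mulrA mulfV// mul1r.
rewrite exprfctE /= -[LHS]/(cos x ^+ n.+1 * cos x +
  sin x * (n.+1%:R * cos x ^+ n * - sin x) + n.+1%:R * cos x ^+ n).
have -> : cos x ^+ n.+1 * cos x + sin x * (n.+1%:R * cos x ^+ n * - sin x)
  + n.+1%:R * cos x ^+ n =
  cos x ^+ n * cos x ^+ 2 + n.+1%:R * cos x ^+ n * (1 - sin x ^+ 2).
  by rewrite exprS; ring.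
by rewrite -cos2sin2 -[n.+2]addn2 exprD -addn1 !natrD; ring.
Qed.

Definition wallis (n : nat) : R := cos_primitive n (pi / 2).

Lemma wallis_rec n : wallis n.+2 = n.+1%:R / n.+2%:R * wallis n.
Proof.
rewrite /wallis /= cos_pihalf expr0n mul0r add0r.
by rewrite -[LHS]/(_ * (_ * _)) mulrA [_^-1 * _]mulrC.
Qed.

Lemma wallis1 : wallis 1 = 1. Proof. exact: sin_pihalf. Qed.

Lemma cos_primitive_at0 n : cos_primitive n 0 = 0.
Proof.
suff : cos_primitive n 0 = 0 /\ cos_primitive n.+1 0 = 0 by case.
elim: n => [|n [IH0 IH1]]; first by split; rewrite //= sin0.
by split => //=; rewrite sin0 mulr0 IH0 scaler0 addr0 scaler0.
Qed.

Lemma wallis_decr n : wallis n.+1 <= wallis n.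
Proof.
have pi2 : 0 < pi / 2 :> R by have := @pihalf_ge1 R; lra.
pose f x := cos_primitive n x - cos_primitive n.+1 x.
have df (x : R) : is_derive x 1 f (cos x ^+ n - cos x ^+ n.+1).
  exact: is_deriveB (is_derive_cos_primitive n x) (is_derive_cos_primitive n.+1 x).
have [|c] := @MVT R f (fun x => cos x ^+ n - cos x ^+ n.+1) _ _ pi2 (fun x _ => df x).
  by apply: derivable_within_continuous => x _; apply: ex_derive.
rewrite in_itv /= /f !cos_primitive_at0 !subr0 => /andP[c0 cpi] h.
rewrite -subr_ge0 h mulr_ge0 ?(ltW pi2)//.
have cc : 0 < cos c by apply: cos_gt0_pihalf; rewrite cpi andbT; lra.
rewrite exprS -[X in X - _]mul1r -mulrBl mulr_ge0 ?exprn_ge0 ?(ltW cc)//.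
Qed.

(** The central probabilities of the lazy walk are the even integrals and, up
    to inversion, the odd ones. *)
Lemma wallis_even m : wallis m.*2 = pi / 2 * lazy_prob R m 0.
Proof.
elim: m => [|m IH]; first by rewrite /= mulr1.
rewrite doubleS wallis_rec IH lazy_prob0S.
have -> : m.*2.+2%:R = 2 * m%:R + 2 :> R by rewrite -addn2 -muln2 natrD natrM; ring.
have -> : m.*2.+1%:R = 2 * m%:R + 1 :> R by rewrite -addn1 -muln2 natrD natrM; ring.
ring.
Qed.

Lemma wallis_odd m : wallis m.*2.+1 * lazy_prob R m 0 * (2 * m%:R + 1) = 1.
Proof.
elim: m => [|m IH]; first by rewrite wallis1 /= mulr0 add0r !mulr1.
rewrite doubleS wallis_rec lazy_prob0S -[RHS]IH.
have -> : m.*2.+3%:R = 2 * m%:R + 3 :> R by rewrite -addn3 -muln2 natrD natrM; ring.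
have -> : m.*2.+2%:R = 2 * m%:R + 2 :> R by rewrite -addn2 -muln2 natrD natrM; ring.
have -> : m.+1%:R = m%:R + 1 :> R by rewrite natr1.
have m0 : 0 <= m%:R :> R by [].
by field; rewrite !lt0r_neq0//; lra.
Qed.

(** Consecutive Wallis integrals are compared: the even one is [pi / 2] times the
    probability, the odd one the inverse of [2 m] times the probability. *)
Lemma lazy_prob0_sqr_le_pi m : lazy_prob R m.+1 0 ^+ 2 <= (pi * m.+1%:R)^-1.
Proof.
have p0 := @pi_gt0 R.
have h := wallis_decr m.*2.+1.
rewrite -[m.*2.+2]/(m.+1.*2) wallis_even in h.
have ho := wallis_odd m.
have m0 : 0 <= m%:R :> R by [].
have b0 := lazy_prob_ge0 R m.+1 0.
have e : wallis m.*2.+1 * lazy_prob R m.+1 0 * (2 * (m%:R + 1)) = 1.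
  rewrite -[RHS]ho lazy_prob0S; field; rewrite lt0r_neq0//; lra.
rewrite -div1r ler_pdivlMr ?mulr_gt0// -natr1.
have : 0 <= lazy_prob R m.+1 0 * (2 * (m%:R + 1)) by rewrite !mulr_ge0//; lra.
move=> /(ler_wpM2r)/(_ _ _ h); move: e.
move: (wallis _) (lazy_prob R m.+1 0) (m%:R : R) (pi : R) => W b M p e.
by move=> h2; lra.
Qed.

Lemma harmonic_le_ln n : \sum_(1 <= m < n.+2) (m%:R : R)^-1 <= 1 + ln n.+1%:R.
Proof.
elim: n => [|n IH]; first by rewrite big_nat1 invr1 ln1 addr0.
rewrite big_nat_recr//=; apply: (le_trans (lerD IH (lexx _))).
rewrite -addrA lerD2l.
have n1 : 0 < n.+1%:R :> R by rewrite ltr0n.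
have n2 : 0 < n.+2%:R :> R by rewrite ltr0n.
have : ln (1 + - n.+2%:R^-1) <= - n.+2%:R^-1 :> R.
  by apply: le_ln1Dx; rewrite ltrN2 invf_lt1// ltr1n.
have -> : 1 + - n.+2%:R^-1 = n.+1%:R / n.+2%:R :> R.
  apply: (mulIf (lt0r_neq0 n2)); rewrite divfK ?lt0r_neq0// mulrDl mulNr.
  by rewrite mulVf ?lt0r_neq0// mul1r -[n.+2]addn1 natrD addrK.
rewrite ln_div ?posrE//; move: (ln n.+1%:R : R) (ln n.+2%:R : R) (n.+2%:R^-1 : R) => a b c; lra.
Qed.

Lemma green_origin_le n : (0 < n)%N -> green R n 0 0 <= (1 + ln n%:R) / pi.
Proof.
case: n => // n _; rewrite ler_pdivlMr ?pi_gt0// (le_trans _ (harmonic_le_ln n))//.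
rewrite /green mulr_suml !big_add1 /= ler_sum// => m _.
rewrite /kernel -expr2 -ler_pdivlMr ?pi_gt0// -invfM.
by rewrite (le_trans (lazy_prob0_sqr_le_pi m))// mulrC.
Qed.

End Wallis.

(** * Marginals of the uniform mean *)

Section Marginals.
Variables (R : realType) (I B : finType).
Hypothesis B_gt0 : (0 < #|B|)%N.

Lemma mean_pair (A C : finType) (F : A -> C -> R) :
  mean (fun p : A * C => F p.1 p.2) = mean (fun a => mean (F a)).
Proof.
rewrite /mean card_prod natrM invfM -(pair_bigA _ F) /= -mulrA; congr (_ * _).
by rewrite -mulr_sumr.
Qed.

Definition upd (a : {ffun I -> B}) (i : I) (s : B) : {ffun I -> B} :=
  [ffun j => if j == i then s else a j].

Lemma mean_resample (i : I) (f : {ffun I -> B} -> R) :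
  mean f = mean (fun s : B => mean (fun a => f (upd a i s))).
Proof.
rewrite -(mean_pair (fun s a => f (upd a i s))).
pose sw (p : B * {ffun I -> B}) := (p.2 i, upd p.2 i p.1).
have swK : involutive sw.
  move=> [s a]; rewrite /sw /= ffunE eqxx; congr (_, _); apply/ffunP => j.
  by rewrite !ffunE; case: eqP => [->|].
rewrite {2}/mean (reindex_inj (inv_inj swK)) /=.
rewrite (eq_bigr (fun p : B * {ffun I -> B} => f p.2)); last first.
  move=> [s a] _ /=; congr f; apply/ffunP => j; rewrite !ffunE.
  by case: eqP => [->|].
rewrite -/(mean (fun p : B * {ffun I -> B} => f p.2)) (mean_pair (fun=> f)).
by rewrite mean_cst.
Qed.

Lemma mean_coord (i : I) (F : B -> {ffun I -> B} -> R) :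
  (forall s, depends_on (~: [set i]%SET) (F s)) ->
  mean (fun a : {ffun I -> B} => F (a i) a) = mean (fun s => mean (F s)).
Proof.
move=> Fi; rewrite (mean_resample i); apply: eq_mean => s; apply: eq_mean => a.
rewrite ffunE eqxx; apply: Fi => j; rewrite !inE => /negbTE ji.
by rewrite ffunE ji.
Qed.

Lemma mean_coord1 (i : I) (F : B -> R) : mean (fun a : {ffun I -> B} => F (a i)) = mean F.
Proof.
rewrite (mean_coord (F := fun s _ => F s))//; apply: eq_mean => s.
by rewrite mean_cst// card_ffun expn_gt0 B_gt0.
Qed.

Lemma mean_coord2 (i j : I) (F : B -> B -> R) : i != j ->
  mean (fun a : {ffun I -> B} => F (a i) (a j)) = mean (fun p : B * B => F p.1 p.2).
Proof.
move=> ij; rewrite (mean_coord (i := i) (F := fun s a => F s (a j))); last first.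
  by move=> s a b ab; rewrite ab// !inE eq_sym.
by rewrite mean_pair; apply: eq_mean => s; rewrite (mean_coord1 j (F s)).
Qed.

Lemma mean_coord3 (i j k : I) (F : B -> B -> B -> R) : distinct3 i j k ->
  mean (fun a : {ffun I -> B} => F (a i) (a j) (a k)) =
  mean (fun p : B * (B * B) => F p.1 p.2.1 p.2.2).
Proof.
move=> /and3P[ij ik jk].
rewrite (mean_coord (i := i) (F := fun s a => F s (a j) (a k))); last first.
  by move=> s a b ab; rewrite !ab// !inE eq_sym.
rewrite (mean_pair (fun s p => F s p.1 p.2)); apply: eq_mean => s.
exact: (mean_coord2 (F s) jk).
Qed.

End Marginals.

(** * Increments of squared distances of two and three walkers *)

Section StepMoments.
Variable R : realType.

Definition dist2 (p q : R * R) : R := (p.1 - q.1) ^+ 2 + (p.2 - q.2) ^+ 2.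

Definition take_step (p : R * R) (s : step) : R * R := (p.1 + s.1%:R, p.2 + s.2%:R).

Definition dist3 (p q r : R * R) : R := dist2 p q + dist2 p r + dist2 q r.

Lemma dist2_ge0 p q : 0 <= dist2 p q.
Proof. by rewrite addr_ge0 ?sqr_ge0. Qed.

Lemma dist2C p q : dist2 p q = dist2 q p.
Proof. by rewrite /dist2; ring. Qed.

Lemma dist3_ge0 p q r : 0 <= dist3 p q r.
Proof. rewrite /dist3; have := dist2_ge0 p q; have := dist2_ge0 p r; have := dist2_ge0 q r; lra. Qed.

Lemma card_step : #|{: step}| = 4%N.
Proof. by rewrite card_prod card_bool. Qed.

Definition dist2_incr (p q : R * R) (s t : step) : R :=
  dist2 (take_step p s) (take_step q t) - dist2 p q.

Lemma mean_dist2_incr p q :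
  mean (fun s : step * (step * step) => dist2_incr p q s.1 s.2.1) = 1.
Proof.
rewrite (mean_pair (fun s t => dist2_incr p q s t.1)).
under eq_mean => s do rewrite (mean_pair (fun t u => dist2_incr p q s t)).
rewrite /mean card_step !sum_bool2 /dist2_incr /dist2 /=; by field.
Qed.

Lemma mean_dist2_incr_sqr p q :
  mean (fun s : step * (step * step) => dist2_incr p q s.1 s.2.1 ^+ 2) =
  2 * dist2 p q + 3 / 2.
Proof.
rewrite (mean_pair (fun s t => dist2_incr p q s t.1 ^+ 2)).
under eq_mean => s do rewrite (mean_pair (fun t u => dist2_incr p q s t ^+ 2)).
rewrite /mean card_step !sum_bool2 /dist2_incr /dist2 /=; by field.
Qed.

Definition dist3_incr p q r (s : step * (step * step)) :=
  dist3 (take_step p s.1) (take_step q s.2.1) (take_step r s.2.2) - dist3 p q r.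

Lemma mean_dist3_incr p q r : mean (dist3_incr p q r) = 3.
Proof.
rewrite (mean_pair (fun s t => dist3_incr p q r (s, t))).
under eq_mean => s do rewrite (mean_pair (fun t u => dist3_incr p q r (s, (t, u)))).
rewrite /mean card_step !sum_bool2 /dist3_incr /dist3 /dist2 /=; by field.
Qed.

Lemma mean_dist3_incr_sqr p q r :
  mean (fun s => dist3_incr p q r s ^+ 2) = 3 * dist3 p q r + 21 / 2.
Proof.
rewrite (mean_pair (fun s t => dist3_incr p q r (s, t) ^+ 2)).
under eq_mean => s do rewrite (mean_pair (fun t u => dist3_incr p q r (s, (t, u)) ^+ 2)).
rewrite /mean card_step !sum_bool2 /dist3_incr /dist3 /dist2 /=; by field.
Qed.

(** Large enough for the relative increments of shifted squared distances to be
    small, so that second order expansions hold without exception. *)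
Definition shift : R := 100 ^+ 2.

Lemma dist2_incr_small p q s t :
  `|dist2_incr p q s t| <= (dist2 p q + 82 * 40) / 40.
Proof.
rewrite /dist2_incr /dist2 /take_step /=.
have -> : p.1 + s.1%:R - (q.1 + t.1%:R) = p.1 - q.1 + (s.1%:R - t.1%:R) by ring.
have -> : p.2 + s.2%:R - (q.2 + t.2%:R) = p.2 - q.2 + (s.2%:R - t.2%:R) by ring.
move: (p.1 - q.1) (p.2 - q.2) => u v; move: s t => [s1 s2] [t1 t2] /=.
have h1 := sqr_ge0 (u - 40); have h2 := sqr_ge0 (u + 40).
have h3 := sqr_ge0 (v - 40); have h4 := sqr_ge0 (v + 40).
rewrite ler_norml; apply/andP.
by case: s1; case: s2; case: t1; case: t2 => /=; split; lra.
Qed.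

Lemma dist2_incr_sqr_le p q s t : dist2_incr p q s t ^+ 2 <= 16 * (dist2 p q + shift).
Proof.
rewrite /dist2_incr /dist2 /take_step /=.
have -> : p.1 + s.1%:R - (q.1 + t.1%:R) = p.1 - q.1 + (s.1%:R - t.1%:R) by ring.
have -> : p.2 + s.2%:R - (q.2 + t.2%:R) = p.2 - q.2 + (s.2%:R - t.2%:R) by ring.
move: (p.1 - q.1) (p.2 - q.2) => u v; move: s t => [s1 s2] [t1 t2] /=.
have d (x y : bool) : exists2 e : R, x%:R - y%:R = e & e ^+ 2 <= 1.
  by case: x; case: y; eexists; rewrite ?(subrr, subr0, sub0r, expr0n, expr1n, sqrrN)//.
have [e -> he] := d s1 t1; have [f -> hf] := d s2 t2.
have -> : (u + e) ^+ 2 + (v + f) ^+ 2 - (u ^+ 2 + v ^+ 2) =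
  2 * (u * e + v * f) + (e ^+ 2 + f ^+ 2) by ring.
have h1 : (u * e + v * f) ^+ 2 <= 2 * (u ^+ 2 + v ^+ 2).
  have : 0 <= u ^+ 2 * (1 - e ^+ 2) by rewrite mulr_ge0 ?sqr_ge0 ?subr_ge0.
  have : 0 <= v ^+ 2 * (1 - f ^+ 2) by rewrite mulr_ge0 ?sqr_ge0 ?subr_ge0.
  by have := sqr_ge0 (u * e - v * f); lra.
have h2 : (e ^+ 2 + f ^+ 2) ^+ 2 <= 4.
  rewrite (_ : 4 = 2 ^+ 2); last by ring.
  by rewrite ler_pXn2r// ?nnegrE ?addr_ge0 ?sqr_ge0//; lra.
move: h1 h2; set c := _ + v * f; set w := _ + f ^+ 2 => h1 h2.
by rewrite /shift; have := sqr_ge0 (2 * c - w); lra.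
Qed.

Lemma dist3_incrE p q r s : dist3_incr p q r s =
  dist2_incr p q s.1 s.2.1 + dist2_incr p r s.1 s.2.2 + dist2_incr q r s.2.1 s.2.2.
Proof. by rewrite /dist3_incr /dist3 /dist2_incr; ring. Qed.

Lemma dist3_incr_small p q r s : `|dist3_incr p q r s| <= (dist3 p q r + shift) / 40.
Proof.
rewrite dist3_incrE; apply: (le_trans (ler_normD _ _)).
have := ler_normD (dist2_incr p q s.1 s.2.1) (dist2_incr p r s.1 s.2.2).
have := dist2_incr_small p q s.1 s.2.1; have := dist2_incr_small p r s.1 s.2.2.
have := dist2_incr_small q r s.2.1 s.2.2; rewrite /dist3 /shift; lra.
Qed.

Lemma dist3_incr_sqr_le p q r s : dist3_incr p q r s ^+ 2 <= 144 * (dist3 p q r + shift).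
Proof.
rewrite dist3_incrE.
have := dist2_incr_sqr_le p q s.1 s.2.1; have := dist2_incr_sqr_le p r s.1 s.2.2.
have := dist2_incr_sqr_le q r s.2.1 s.2.2; have := dist3_ge0 p q r.
rewrite /dist3; move: (dist2_incr _ _ _ _) (dist2_incr _ _ _ _) (dist2_incr _ _ _ _).
move=> c b a h0 h1 h2 h3.
have := sqr_ge0 (a - b); have := sqr_ge0 (a - c); have := sqr_ge0 (b - c).
have : 0 <= shift by rewrite /shift; lra.
lra.
Qed.

End StepMoments.

(** * Elementary second order inequalities and the triple corrector *)

Section Taylor.
Variable R : realType.
Implicit Types w X d q : R.

Lemma ler_sqr_le (x y : R) : 0 <= y -> x ^+ 2 <= y ^+ 2 -> x <= y.
Proof.
move=> y0; have [x0|x0] := leP 0 x; last by move=> _; rewrite (le_trans (ltW x0)).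
by rewrite ler_pXn2r.
Qed.

Lemma norm_le_sqr (x c : R) : 0 <= c -> x ^+ 2 <= c ^+ 2 -> `|x| <= c.
Proof. by move=> c0 h; apply: ler_sqr_le => //; rewrite real_normK ?num_real. Qed.

(** The constant 1/6 exceeds the Taylor constant 1/8, which leaves room for the
    third order term, and stays below 1/4, which keeps the drift of the
    distance of two planar walkers positive. *)
Lemma sqrt_second_order X d : 0 < X -> `|d| <= X / 40 ->
  Num.sqrt X + (d / (2 * Num.sqrt X) - d ^+ 2 / (6 * Num.sqrt X ^+ 3)) <=
  Num.sqrt (X + d).
Proof.
move=> X0; set q := Num.sqrt X.
have q0 : 0 < q by rewrite sqrtr_gt0.
have qq : q ^+ 2 = X by rewrite sqr_sqrtr// ltW.
rewrite ler_norml => /andP[hd1 hd2].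
apply: ler_sqr_le; rewrite ?sqrtr_ge0// sqr_sqrtr; last by lra.
rewrite -qq in hd1 hd2 *.
pose w := d / q ^+ 2.
have q20 : 0 < q ^+ 2 by rewrite exprn_gt0.
have dE : d = w * q ^+ 2 by rewrite /w mulfVK// lt0r_neq0.
have w1 : - (1 / 40) <= w by rewrite /w ler_pdivlMr//; lra.
have w2 : w <= 1 / 40 by rewrite /w ler_pdivrMr//; lra.
have -> : q + (d / (2 * q) - d ^+ 2 / (6 * q ^+ 3)) = q * (1 + w / 2 - w ^+ 2 / 6).
  by rewrite dE; field; rewrite lt0r_neq0.
have -> : q ^+ 2 + d = q ^+ 2 * (1 + w) by rewrite dE; ring.
rewrite exprMn ler_pM2l// -subr_ge0.
have -> : 1 + w - (1 + w / 2 - w ^+ 2 / 6) ^+ 2 =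
  w ^+ 2 * (1 / 12 + w / 6 - w ^+ 2 / 36) by field.
by rewrite mulr_ge0 ?sqr_ge0//; nra.
Qed.

Lemma sqrt_lipschitz (X Y : R) : 0 < X -> 0 <= Y ->
  `|Num.sqrt Y - Num.sqrt X| <= `|Y - X| / Num.sqrt X.
Proof.
move=> X0 Y0; set q := Num.sqrt X; set q' := Num.sqrt Y.
have q0 : 0 < q by rewrite sqrtr_gt0.
have q'0 : 0 <= q' by rewrite sqrtr_ge0.
have -> : Y - X = (q' - q) * (q' + q).
  by rewrite -subr_sqr !sqr_sqrtr// ltW.
rewrite ler_pdivlMr// normrM ler_wpM2l// ger0_norm; lra.
Qed.

Lemma inv_convex (q q' : R) : 0 < q -> 0 < q' ->
  q^-1 - (q' ^+ 2 - q ^+ 2) / (2 * q ^+ 3) <= q'^-1.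
Proof.
move=> q0 q'0; rewrite -subr_ge0.
have -> : q'^-1 - (q^-1 - (q' ^+ 2 - q ^+ 2) / (2 * q ^+ 3)) =
  (q' - q) ^+ 2 * (q' + 2 * q) / (2 * q ^+ 3 * q').
  by field; rewrite !lt0r_neq0.
apply: divr_ge0; apply: mulr_ge0; rewrite ?sqr_ge0 ?(ltW q'0)//; first by lra.
by rewrite mulr_ge0// exprn_ge0// ltW.
Qed.

(** The constant 9/10, below 1, is what makes the logarithm of the squared
    distance of three planar points, a Bessel process of dimension four,
    strictly subharmonic. *)
Lemma ln_second_order w : `|w| <= 1 / 8 -> w - 9 / 10 * w ^+ 2 <= ln (1 + w).
Proof.
rewrite ler_norml => /andP[w1 w2].
set x := w - 9 / 10 * w ^+ 2.
have w3 : w ^+ 2 <= 1 / 64 by nra.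
have w0 := sqr_ge0 w.
have hx : expR x * (1 - x / 2) ^+ 2 <= 1.
  have h1 : 1 - x / 2 <= expR (- (x / 2)) by rewrite expR_ge1Dx.
  have h2 : 0 <= 1 - x / 2 by rewrite /x; lra.
  have -> : expR x = expR (x / 2) ^+ 2 by rewrite -expRM_natl; congr expR; field.
  rewrite -exprMn exprn_ile1 ?mulr_ge0 ?expR_ge0//.
  apply: (le_trans (ler_wpM2l (expR_ge0 _) h1)).
  by rewrite -expRD subrr expR0.
have hw : 1 <= (1 + w) * (1 - x / 2) ^+ 2.
  rewrite -subr_ge0.
  have -> : (1 + w) * (1 - x / 2) ^+ 2 - 1 =
    w ^+ 2 * (3 / 20 + 7 / 10 * w - 99 / 400 * w ^+ 2 + 81 / 400 * w ^+ 3).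
    by rewrite /x; field.
  apply: mulr_ge0; first exact: sqr_ge0.
  have : 0 <= (w + 1 / 8) * (w ^+ 2 - w / 8 + 1 / 64) by apply: mulr_ge0; lra.
  lra.
rewrite -[leLHS]expRK ler_ln ?posrE ?expR_gt0//; last by lra.
have t0 : 0 < (1 - x / 2) ^+ 2 by rewrite exprn_gt0// /x; lra.
by rewrite -(ler_pM2r t0) (le_trans hx).
Qed.

Lemma ln_norm_le w : `|w| <= 1 / 8 -> `|ln (1 + w)| <= 2 * `|w|.
Proof.
move=> hw; have := ln_second_order hw.
have : ln (1 + w) <= w.
  by apply: le_ln1Dx; move: hw; rewrite ler_norml; lra.
have h3 : w ^+ 2 <= `|w|.
  by rewrite -real_normK ?num_real// expr2 ler_piMr//; lra.
have := ler_norm w; have := ler_norm (- w); rewrite normrN.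
by rewrite (ler_norml (ln _)) => *; apply/andP; split; lra.
Qed.

Lemma ln_ratio_norm_le (X Y : R) : 0 < X -> `|Y - X| <= X / 8 ->
  `|ln Y - ln X| <= 2 * (`|Y - X| / X).
Proof.
move=> X0 h; have Y0 : 0 < Y by move: h; rewrite ler_norml => /andP[]; lra.
have e : Y / X = 1 + (Y - X) / X by field; rewrite lt0r_neq0.
have nE : `|(Y - X) / X| = `|Y - X| / X by rewrite normrM normfV (gtr0_norm X0).
rewrite -ln_div ?posrE// e -nE; apply: ln_norm_le.
by rewrite nE ler_pdivrMr//; lra.
Qed.

End Taylor.

Section Corrector.
Variable R : realType.
Local Notation shift := (shift R).

Definition proximity (p q : R * R) : R := (Num.sqrt (dist2 p q + shift))^-1.
Definition proximity3 (p q r : R * R) : R := (Num.sqrt (dist3 p q r + shift))^-1.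

(** The distance of two planar walkers has a drift of the order of its inverse,
    so the subtracted quotient supplies the required singular drift.  The
    logarithm, whose drift is minus the inverse squared size of the triangle,
    pays for the errors made by dividing by that size. *)
Definition corrector (n : nat) (p q r : R * R) : R :=
  400 * (ln (3 * n%:R + (dist3 p q r + shift)) - ln (dist3 p q r + shift)) +
  (1 - Num.sqrt (dist2 p q + shift) / Num.sqrt (dist3 p q r + shift)).

Lemma shift_gt0 : 0 < shift. Proof. by rewrite exprn_gt0. Qed.

Variables (p q r : R * R).

Let X : R := dist2 p q + shift.
Let Y : R := dist3 p q r + shift.
Let P : R := Num.sqrt X.
Let Q : R := Num.sqrt Y.

Let X0 : 0 < X. Proof. by have := dist2_ge0 p q; have := shift_gt0; rewrite /X; lra. Qed.
Let Y0 : 0 < Y. Proof. by have := dist3_ge0 p q r; have := shift_gt0; rewrite /Y; lra. Qed.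
Let P0 : 0 < P. Proof. by rewrite sqrtr_gt0. Qed.
Let Q0 : 0 < Q. Proof. by rewrite sqrtr_gt0. Qed.
Let PP : P ^+ 2 = X. Proof. by rewrite sqr_sqrtr// ltW. Qed.
Let QQ : Q ^+ 2 = Y. Proof. by rewrite sqr_sqrtr// ltW. Qed.
Let XY : X <= Y.
Proof.
by rewrite /X /Y /dist3; have := dist2_ge0 p r; have := dist2_ge0 q r; lra.
Qed.
Let PQ : P <= Q. Proof. by rewrite ler_wsqrtr. Qed.
Let Q100 : 100 <= Q.
Proof.
have -> : 100 = Num.sqrt shift by rewrite sqrtr_sqr ger0_norm.
by rewrite ler_wsqrtr// /Y lerDr dist3_ge0.
Qed.

Local Ltac facts :=
  pose proof X0; pose proof Y0; pose proof P0; pose proof Q0;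
  pose proof XY; pose proof PQ; pose proof Q100.

Lemma corrector_ge0 n : 0 <= corrector n p q r.
Proof.
rewrite /corrector -/X -/Y -/P -/Q; apply: addr_ge0.
  apply: mulr_ge0; first by lra.
  rewrite subr_ge0 ler_ln ?posrE//; last first.
    by rewrite ltr_wpDl// mulr_ge0.
  by rewrite lerDr mulr_ge0.
by rewrite subr_ge0 ler_pdivrMr// mul1r.
Qed.

Section Increment.
Variables (n : nat) (s : step * (step * step)).
Let d : R := dist2_incr p q s.1 s.2.1.
Let e : R := dist3_incr p q r s.
Let p' := take_step p s.1.
Let q' := take_step q s.2.1.
Let r' := take_step r s.2.2.

Let XE : dist2 p' q' + shift = X + d. Proof. by rewrite /X /d /dist2_incr; ring. Qed.
Let YE : dist3 p' q' r' + shift = Y + e. Proof. by rewrite /Y /e /dist3_incr; ring. Qed.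

Let d40 : `|d| <= X / 40.
Proof.
apply: (le_trans (dist2_incr_small p q s.1 s.2.1)).
by rewrite /X ler_pM2r// lerD2l /shift; lra.
Qed.
Let e40 : `|e| <= Y / 40. Proof. exact: dist3_incr_small. Qed.

Let dP : `|d| <= 4 * P.
Proof.
apply: norm_le_sqr; first by rewrite mulr_ge0// ltW.
by rewrite exprMn PP (le_trans (dist2_incr_sqr_le p q s.1 s.2.1))// /X; lra.
Qed.
Let eQ : `|e| <= 12 * Q.
Proof.
apply: norm_le_sqr; first by rewrite mulr_ge0// ltW.
by rewrite exprMn QQ (le_trans (dist3_incr_sqr_le p q r s))// /Y; lra.
Qed.
Let Xd0 : 0 < X + d. Proof. by facts; have := d40; rewrite ler_norml; lra. Qed.
Let Ye0 : 0 < Y + e. Proof. by facts; have := e40; rewrite ler_norml; lra. Qed.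

Let P' : R := Num.sqrt (X + d).
Let Q' : R := Num.sqrt (Y + e).
Let Q'0 : 0 < Q'. Proof. by rewrite sqrtr_gt0. Qed.
Let Q'Q : Q / 2 <= Q'.
Proof.
facts.
apply: ler_sqr_le; first by rewrite ltW.
rewrite sqr_sqrtr ?(ltW Ye0)// expr_div_n QQ.
by have := e40; rewrite ler_norml; lra.
Qed.

Let P'P : `|P' - P| <= 4.
Proof.
facts.
apply: (le_trans (sqrt_lipschitz X0 (ltW Xd0))).
by rewrite addrAC subrr add0r ler_pdivrMr.
Qed.
Let Q'Q12 : `|Q' - Q| <= 12.
Proof.
facts.
apply: (le_trans (sqrt_lipschitz Y0 (ltW Ye0))).
by rewrite addrAC subrr add0r ler_pdivrMr.
Qed.
Let invQ'Q : `|Q'^-1 - Q^-1| <= 24 / Y.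
Proof.
facts.
have -> : Q'^-1 - Q^-1 = - ((Q' - Q) / (Q * Q')) by field; rewrite !lt0r_neq0.
rewrite normrN normrM normfV (gtr0_norm (mulr_gt0 Q0 Q'0)).
rewrite ler_pdivrMr ?mulr_gt0// mulrAC ler_pdivlMr// -QQ.
apply: (le_trans (ler_wpM2r (sqr_ge0 Q) Q'Q12)).
have := ler_wpM2l (ltW Q0) Q'Q; lra.
Qed.

Let quotient_ge :
  Q^-1 * (d / (2 * P) - d ^+ 2 / (6 * P ^+ 3)) - P * (e / (2 * Q ^+ 3)) - 96 / Y <=
  P' / Q' - P / Q.
Proof.
facts.
have h1 : d / (2 * P) - d ^+ 2 / (6 * P ^+ 3) <= P' - P.
  by have := sqrt_second_order X0 d40; rewrite -/P -/P'; lra.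
have h2 : - (e / (2 * Q ^+ 3)) <= Q'^-1 - Q^-1.
  have := inv_convex Q0 Q'0; rewrite QQ (sqr_sqrtr (ltW Ye0)).
  by rewrite addrAC subrr add0r; lra.
have h3 : - (96 / Y) <= (P' - P) * (Q'^-1 - Q^-1).
  have : `|(P' - P) * (Q'^-1 - Q^-1)| <= 96 / Y.
    rewrite normrM; apply: (le_trans (ler_pM (normr_ge0 _) (normr_ge0 _) P'P invQ'Q)).
    by rewrite mulrA; lra.
  by rewrite ler_norml => /andP[].
have Qi : 0 <= Q^-1 by rewrite invr_ge0 ltW.
have -> : P' / Q' - P / Q = Q^-1 * (P' - P) + P * (Q'^-1 - Q^-1) + (P' - P) * (Q'^-1 - Q^-1).
  by ring.
have := ler_wpM2l Qi h1; have := ler_wpM2l (ltW P0) h2; lra.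
Qed.

Let quotient_norm : `|P' / Q' - P / Q| <= 29 / Q.
Proof.
facts.
have -> : P' / Q' - P / Q = Q^-1 * (P' - P) + P * (Q'^-1 - Q^-1) + (P' - P) * (Q'^-1 - Q^-1).
  by ring.
have Qi : 0 <= Q^-1 by rewrite invr_ge0 ltW.
have Yi : 24 / Y = 24 * Q^-1 * Q^-1 by rewrite -QQ; field; rewrite lt0r_neq0.
have h1 : `|Q^-1 * (P' - P)| <= Q^-1 * 4.
  by rewrite normrM (ger0_norm Qi) ler_wpM2l.
have h2 : `|P * (Q'^-1 - Q^-1)| <= 24 * Q^-1.
  rewrite normrM (gtr0_norm P0); apply: (le_trans (ler_wpM2l (ltW P0) invQ'Q)).
  rewrite Yi mulrCA ler_piMr ?mulr_ge0//.
  by rewrite ler_pdivrMr// mul1r.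
have h3 : `|(P' - P) * (Q'^-1 - Q^-1)| <= Q^-1.
  rewrite normrM; apply: (le_trans (ler_pM (normr_ge0 _) (normr_ge0 _) P'P invQ'Q)).
  rewrite Yi !mulrA ler_piMl// ler_pdivrMr//; lra.
apply: (le_trans (ler_normD _ _)).
by have := ler_normD (Q^-1 * (P' - P)) (P * (Q'^-1 - Q^-1)); lra.
Qed.

Definition corrector_incr := corrector n p' q' r' - corrector n.+1 p q r.

Let incrE : corrector_incr =
  400 * ((ln (3 * n%:R + (Y + e)) - ln (3 * n.+1%:R + Y)) - (ln (Y + e) - ln Y)) -
  (P' / Q' - P / Q).
Proof. by rewrite /corrector_incr /corrector XE YE -/X -/Y -/P -/Q -/P' -/Q'; ring. Qed.

Let n0 : 0 <= n%:R :> R. Proof. by []. Qed.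
Let Z : R := 3 * n.+1%:R + Y.
Let Z0 : 0 < Z. Proof. by facts; rewrite /Z -natr1; have := n0; lra. Qed.
Let ZE : 3 * n%:R + (Y + e) = Z + (e - 3). Proof. by rewrite /Z -natr1; ring. Qed.
Let Y100 : 100 * Q <= Y. Proof. by rewrite -QQ expr2 ler_pM2r. Qed.

Lemma corrector_incr_le :
  corrector_incr <=
  400 * ((e - 3) / Z - e / Y + 9 / 10 * (e ^+ 2 / Y ^+ 2)) -
  (Q^-1 * (d / (2 * P) - d ^+ 2 / (6 * P ^+ 3)) - P * (e / (2 * Q ^+ 3)) - 96 / Y).
Proof.
facts.
rewrite incrE -/Z ZE.
have ZY : Y <= Z by rewrite /Z lerDr mulr_ge0.
have h1 : ln (Z + (e - 3)) - ln Z <= (e - 3) / Z.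
  have zp : 0 < Z + (e - 3).
    by have := e40; have := Y100; rewrite ler_norml; lra.
  rewrite -ln_div ?posrE//.
  have -> : (Z + (e - 3)) / Z = 1 + (e - 3) / Z by field; rewrite lt0r_neq0.
  by apply: le_ln1Dx; rewrite ltr_pdivlMr//; lra.
have h2 : e / Y - 9 / 10 * (e ^+ 2 / Y ^+ 2) <= ln (Y + e) - ln Y.
  rewrite -ln_div ?posrE//.
  have -> : (Y + e) / Y = 1 + e / Y by field; rewrite lt0r_neq0.
  rewrite -expr_div_n; apply: ln_second_order.
  by rewrite normrM normfV (gtr0_norm Y0) ler_pdivrMr//; have := e40; lra.
have := quotient_ge; lra.
Qed.

Lemma corrector_incr_norm : `|corrector_incr| <= 201 * 100 / Q.
Proof.
facts.
rewrite incrE -/Z ZE.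
have ZY : Y <= Z by rewrite /Z lerDr mulr_ge0.
have Qi : 0 <= Q^-1 by rewrite invr_ge0 ltW.
have h1 : `|ln (Z + (e - 3)) - ln Z| <= 26 / Q.
  have e3 : `|e - 3| <= 13 * Q.
    apply: (le_trans (ler_normB _ _)); rewrite (@ger0_norm _ 3)//.
    by have := eQ; have := Q100; lra.
  have e3' : `|e - 3| <= Z / 8.
    apply: (le_trans (ler_normB _ _)); rewrite (@ger0_norm _ 3)//.
    by have := e40; have := Q100; have := Y100; lra.
  have := @ln_ratio_norm_le _ Z (Z + (e - 3)) Z0.
  rewrite [Z + _ - Z]addrC addKr => /(_ e3') h.
  apply: (le_trans h).
  rewrite mulrA ler_pdivrMr// mulrAC ler_pdivlMr//.
  have := ler_wpM2r (ltW Q0) e3; rewrite -mulrA -expr2 QQ; lra.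
have h2 : `|ln (Y + e) - ln Y| <= 24 / Q.
  have e5 : `|e| <= Y / 8 by have := e40; lra.
  have := @ln_ratio_norm_le _ Y (Y + e) Y0.
  rewrite [Y + _ - Y]addrC addKr => /(_ e5) h.
  apply: (le_trans h).
  rewrite mulrA ler_pdivrMr// mulrAC ler_pdivlMr//.
  have := ler_wpM2r (ltW Q0) eQ; rewrite -mulrA -expr2 QQ; lra.
have := quotient_norm.
move: h1 h2; rewrite !ler_norml => /andP[a1 a2] /andP[b1 b2] /andP[c1 c2].
by apply/andP; split; lra.
Qed.

End Increment.

(** With shifted squared distances X of [p], [q] and Y of the triangle, the
    logarithm contributes at most - (400 * 3/10) / Y, because the increment of
    Y has mean 3 and second moment about 3 Y.  The quotient contributes
    - 1/6 of the product of proximities, because the increment of X has mean 1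
    and second moment about 2 X, and an error of at most 98 / Y. *)
Lemma mean_corrector_incr n :
  mean (corrector_incr n) <= - (1 / 6) * (proximity3 p q r * proximity p q).
Proof.
facts.
have n0 : 0 <= n%:R :> R by [].
pose Z := 3 * n.+1%:R + Y.
have Z0 : 0 < Z by rewrite /Z -natr1; lra.
pose ce := 400 * (Z^-1 - Y^-1) + P / (2 * Q ^+ 3).
apply: (le_trans (ler_mean (corrector_incr_le n))) => /=.
rewrite (_ : (fun s => _) = fun s => ce * dist3_incr p q r s +
   (360 / Y ^+ 2 * (dist3_incr p q r s ^+ 2) +
   (- (Q^-1 / (2 * P)) * dist2_incr p q s.1 s.2.1 +
   (Q^-1 / (6 * P ^+ 3) * (dist2_incr p q s.1 s.2.1) ^+ 2 +
   (96 / Y - 3 * 400 / Z))))); last first.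
  by apply/funext => s; rewrite /ce -/Z; field; rewrite !lt0r_neq0.
rewrite !meanD !meanZ !mean_cst; try by rewrite !card_prod !card_bool.
rewrite mean_dist3_incr mean_dist3_incr_sqr mean_dist2_incr mean_dist2_incr_sqr.
rewrite /proximity3 /proximity -/X -/Y -/P -/Q.
have -> : dist3 p q r = Y - shift by rewrite /Y; ring.
have -> : dist2 p q = X - shift by rewrite /X; ring.
have sh : 100 ^+ 2 = shift by [].
have a1 : P / (2 * Q ^+ 3) <= 1 / 2 / Y.
  have -> : 1 / 2 / Y = Q / (2 * Q ^+ 3) by rewrite -QQ; field; rewrite lt0r_neq0.
  by rewrite ler_wpM2r// invr_ge0 mulr_ge0// exprn_ge0// ltW.
have a2 : 360 / Y ^+ 2 * (3 * (Y - shift) + 21 / 2) <= 1080 / Y.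
  have -> : 1080 / Y = 360 / Y ^+ 2 * (3 * Y) by field; rewrite lt0r_neq0.
  apply: ler_wpM2l; last by lra.
  by apply: divr_ge0; [lra|exact: sqr_ge0].
have a3 : Q^-1 / (6 * P ^+ 3) * (2 * (X - shift) + 3 / 2) <= 1 / 3 * (Q^-1 / P).
  have -> : 1 / 3 * (Q^-1 / P) = Q^-1 / (6 * P ^+ 3) * (2 * X).
    by rewrite -PP; field; rewrite !lt0r_neq0.
  rewrite ler_wpM2l//; last by lra.
  by rewrite mulr_ge0 ?invr_ge0 ?mulr_ge0 ?exprn_ge0 ?(ltW P0) ?(ltW Q0).
have a4 : 0 <= Y^-1 by rewrite invr_ge0 ltW.
have -> : Q^-1 / (2 * P) = 1 / 2 * (Q^-1 / P) by field; rewrite !lt0r_neq0.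
rewrite /ce; lra.
Qed.

End Corrector.

(** * Proximities and pair weights *)

Section Proximity.
Variable R : realType.
Local Notation shift := (shift R).
Implicit Types p q r : R * R.

Let X0 p q : 0 < dist2 p q + shift.
Proof. by have := dist2_ge0 p q; have := shift_gt0 R; lra. Qed.
Let Y0 p q r : 0 < dist3 p q r + shift.
Proof. by have := dist3_ge0 p q r; have := shift_gt0 R; lra. Qed.

Lemma proximity_ge0 p q : 0 <= proximity p q.
Proof. by rewrite invr_ge0 sqrtr_ge0. Qed.

Lemma proximity3_ge0 p q r : 0 <= proximity3 p q r.
Proof. by rewrite invr_ge0 sqrtr_ge0. Qed.

Lemma proximity_le1 p q : proximity p q <= 1.
Proof.
rewrite invf_le1 ?sqrtr_gt0// -[leLHS]sqrtr1 ler_wsqrtr//.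
by have := dist2_ge0 p q; rewrite /shift; lra.
Qed.

Lemma proximityC p q : proximity p q = proximity q p.
Proof. by rewrite /proximity dist2C. Qed.

Lemma proximity3_swap12 p q r : proximity3 p q r = proximity3 q p r.
Proof. by rewrite /proximity3 /dist3 (dist2C p q); congr (Num.sqrt _)^-1; ring. Qed.

Lemma proximity3_swap23 p q r : proximity3 p q r = proximity3 p r q.
Proof. by rewrite /proximity3 /dist3 (dist2C q r); congr (Num.sqrt _)^-1; ring. Qed.

Lemma proximity3_le p q r : proximity3 p q r <= proximity p q.
Proof.
rewrite lef_pV2 ?posrE ?sqrtr_gt0// ler_wsqrtr// lerD2r /dist3.
by have := dist2_ge0 p r; have := dist2_ge0 q r; lra.
Qed.

(** Two edges of a triangle cannot both be short compared with its size. *)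
Lemma proximity_mul_le p q r :
  proximity p q * proximity p r <=
  2 * proximity3 p q r * (proximity p q + proximity p r).
Proof.
rewrite /proximity /proximity3.
set a : R := Num.sqrt (dist2 p q + shift); set b : R := Num.sqrt (dist2 p r + shift).
set c : R := Num.sqrt (dist3 p q r + shift).
have a0 : 0 < a by rewrite sqrtr_gt0.
have b0 : 0 < b by rewrite sqrtr_gt0.
have c0 : 0 < c by rewrite sqrtr_gt0.
have hc : c <= 2 * (a + b).
  have aa : a ^+ 2 = dist2 p q + shift by rewrite sqr_sqrtr// ltW.
  have bb : b ^+ 2 = dist2 p r + shift by rewrite sqr_sqrtr// ltW.
  have cc : c ^+ 2 = dist3 p q r + shift by rewrite sqr_sqrtr// ltW.
  apply: ler_sqr_le; first by lra.
  rewrite cc (_ : (2 * (a + b)) ^+ 2 = 4 * (a ^+ 2 + 2 * (a * b) + b ^+ 2)); last by ring.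
  rewrite aa bb.
  have : dist2 q r <= 2 * (dist2 p q + dist2 p r).
    rewrite /dist2.
    have := sqr_ge0 (2 * p.1 - q.1 - r.1); have := sqr_ge0 (2 * p.2 - q.2 - r.2); lra.
  have := mulr_gt0 a0 b0; have := dist2_ge0 p q; have := dist2_ge0 p r.
  by have := shift_gt0 R; rewrite /dist3; lra.
have -> : 2 / c * (a^-1 + b^-1) = a^-1 * b^-1 * (2 * (a + b) / c).
  by field; rewrite !lt0r_neq0.
by rewrite ler_peMr ?mulr_ge0 ?invr_ge0 ?(ltW a0) ?(ltW b0)// ler_pdivlMr// mul1r.
Qed.

End Proximity.

Section PairWeight.
Variable R : realType.
Variables (N : nat) (sigma kappa : R).
Hypothesis sigma_ge0 : 0 <= sigma.
Hypothesis kappa_ge0 : 0 <= kappa.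
Hypothesis kappaE : kappa = sigma * (1 + kappa * green R N 0 0).

(** By [kappaE], the constant is sigma / (1 - sigma G) with G the Green function
    at the origin: the geometric series of repeated collisions of one pair. *)
Definition pair_profile (n : nat) (k l : int) : R := 1 + kappa * green R n k l.

Lemma pair_profile_ge1 n k l : 1 <= pair_profile n k l.
Proof. by rewrite lerDl mulr_ge0 ?green_ge0. Qed.

Definition pair_weight (n : nat) (k l : int) (s t : step) : R :=
  let k' := k + step_diff s.1 t.1 in let l' := l + step_diff s.2 t.2 in
  (1 + sigma * ((k' == 0) && (l' == 0))%:R) * pair_profile n k' l'
  / pair_profile n.+1 k l.

Lemma pair_weight_ge0 n k l s t : 0 <= pair_weight n k l s t.
Proof.
have pos n' k' l' : 0 <= pair_profile n' k' l'.
  by rewrite (le_trans _ (pair_profile_ge1 _ _ _)).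
by rewrite /pair_weight divr_ge0// mulr_ge0// addr_ge0// mulr_ge0.
Qed.

(* at a collision the extra weight is [sigma] times the maximal profile *)
Let collision_le n k l : (n <= N)%N ->
  sigma * ((k == 0) && (l == 0))%:R * pair_profile n k l <=
  kappa * ((k == 0) && (l == 0))%:R.
Proof.
move=> nN; have [/andP[/eqP -> /eqP ->]|_] := boolP ((k == 0) && (l == 0)).
  rewrite !mulr1 kappaE ler_wpM2l//.
  by rewrite lerD2l ler_wpM2l// green_le.
by rewrite !mulr0 mul0r.
Qed.

(** The Green function loses in the mean exactly the probability of a collision,
    which is what the collision weight gains by the choice of [kappa]. *)
Lemma mean_pair_weight n k l : (n <= N)%N ->
  mean (fun s : step * step => pair_weight n k l s.1 s.2) <= 1.
Proof.
move=> nN.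
have f0 : 0 < pair_profile n.+1 k l by rewrite (lt_le_trans _ (pair_profile_ge1 _ _ _)).
pose c (s : step * step) : R :=
  ((k + step_diff s.1.1 s.2.1 == 0) && (l + step_diff s.1.2 s.2.2 == 0))%:R.
pose g (s : step * step) := green R n (k + step_diff s.1.1 s.2.1) (l + step_diff s.1.2 s.2.2).
apply: (@le_trans _ _ (mean (fun s => (pair_profile n.+1 k l)^-1 *
    (1 + kappa * (c s + g s))))).
  apply: ler_mean => s; rewrite /pair_weight mulrC ler_wpM2l ?invr_ge0 ?(ltW f0)//.
  rewrite mulrDl mul1r {1}/pair_profile.
  have := collision_le (k + step_diff s.1.1 s.2.1) (l + step_diff s.1.2 s.2.2) nN.
  by rewrite /c /g; lra.
rewrite meanZ meanD mean_cst ?card_prod ?card_bool// meanZ.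
rewrite (_ : mean (fun s => c s + g s) = green R n.+1 k l).
  by rewrite -/(pair_profile n.+1 k l) mulVf// lt0r_neq0.
rewrite green_rec /mean !card_prod !card_bool; congr (_ * _).
by rewrite [RHS]pair_bigA.
Qed.

Lemma pair_weight_near1 n k l s t : (n <= N)%N ->
  `|pair_weight n k l s t - 1| <=
  148 * 100 * kappa * (Num.sqrt (sqnorm R k l + shift R))^-1.
Proof.
move=> nN; rewrite /pair_weight.
set k' := k + _; set l' := l + _.
have hk : `|k' - k| <= 1 by rewrite /k' addrC addKr step_diff_le1.
have hl : `|l' - l| <= 1 by rewrite /l' addrC addKr step_diff_le1.
have r0 := sqnorm_ge0 R k l.
have f1 := pair_profile_ge1 n.+1 k l.
have f0 : 0 < pair_profile n.+1 k l by apply: lt_le_trans f1.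
set u : R := Num.sqrt (sqnorm R k l + 1).
have u0 : 0 < u by rewrite sqrtr_gt0; lra.
set v : R := Num.sqrt (sqnorm R k l + shift R).
have v0 : 0 < v by rewrite sqrtr_gt0; have := shift_gt0 R; lra.
have uv : v <= 100 * u.
  apply: ler_sqr_le; first by lra.
  rewrite exprMn !sqr_sqrtr; [|by lra|by have := shift_gt0 R; lra].
  by rewrite /shift; lra.
apply: (@le_trans _ _ (148 * kappa / u)); last first.
  rewrite ler_pdivrMr// mulrAC ler_pdivlMr//.
  have := ler_wpM2l kappa_ge0 uv; lra.
set c : R := ((k' == 0) && (l' == 0))%:R.
have -> : (1 + sigma * c) * pair_profile n k' l' / pair_profile n.+1 k l - 1 =
  (kappa * (green R n k' l' - green R n.+1 k l) + sigma * c * pair_profile n k' l')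
   / pair_profile n.+1 k l.
  by rewrite /pair_profile in f0 *; field; rewrite lt0r_neq0.
rewrite normrM normfV (gtr0_norm f0) ler_pdivrMr//.
apply: (@le_trans _ _ (148 * kappa / u)); last first.
  by rewrite ler_peMr// !mulr_ge0 ?invr_ge0 ?(ltW u0).
apply: (le_trans (ler_normD _ _)); rewrite normrM (ger0_norm kappa_ge0).
have c0 : 0 <= c by [].
have p0 : 0 <= pair_profile n k' l' by rewrite (le_trans _ (pair_profile_ge1 _ _ _)).
rewrite (ger0_norm (mulr_ge0 (mulr_ge0 sigma_ge0 c0) p0)).
have h1 := ler_wpM2l kappa_ge0 (green_step R n hk hl).
have h2 := collision_le k' l' nN.
have h3 : c <= 2 / u.
  rewrite ler_pdivlMr// /c; have [/andP[/eqP k0 /eqP l0]|_] := boolP (_ && _); last by rewrite mul0r.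
  rewrite mul1r; apply: ler_sqr_le => //; rewrite sqr_sqrtr; last by lra.
  have sq (j j' : int) : `|j' - j| <= 1 -> j' = 0 -> (j%:~R : R) ^+ 2 <= 1.
    move=> jj j0; rewrite -real_normK ?num_real// exprn_ile1//.
    rewrite -intr_norm (_ : 1 = 1%:~R)// ler_int.
    by move: jj; rewrite j0 sub0r normrN.
  have := sq _ _ hk k0; have := sq _ _ hl l0; rewrite /sqnorm; lra.
have := ler_wpM2l kappa_ge0 h3; rewrite -/u -/c in h1 h2 *; lra.
Qed.

End PairWeight.

(** * The supersolution for the recursion of the partition function *)

Definition advance (h : nat) (x : 'I_h -> int * int)
    (a : {ffun 'I_h -> bool * bool}) (i : 'I_h) : int * int :=
  ((x i).1 + ((a i).1 : nat)%:Z, (x i).2 + ((a i).2 : nat)%:Z).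

Definition embed (R : realType) (p : int * int) : R * R := (p.1%:~R, p.2%:~R).

Definition gap1 (h : nat) (x : 'I_h -> int * int) (e : 'I_h * 'I_h) : int :=
  (x e.1).1 - (x e.2).1.

Definition gap2 (h : nat) (x : 'I_h -> int * int) (e : 'I_h * 'I_h) : int :=
  (x e.1).2 - (x e.2).2.

Section PartitionFunction.
Variables (R : realType) (h : nat) (sigma : 'I_h * 'I_h -> R).

Definition collision_weight (x : 'I_h -> int * int) : R :=
  \prod_(e in Pairs h) (1 + sigma e * (x e.1 == x e.2)%:R).

Fixpoint partition_function (n : nat) (x : 'I_h -> int * int) : R :=
  if n is n'.+1 then
    mean (fun a : {ffun 'I_h -> step} =>
      collision_weight (advance x a) * partition_function n' (advance x a))
  else 1.

Variables (N : nat) (kappa : 'I_h * 'I_h -> R) (kappa0 H : R).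
Hypothesis sigma_ge0 : forall e, e \in Pairs h -> 0 <= sigma e.
Hypothesis kappa_ge0 : forall e, e \in Pairs h -> 0 <= kappa e.
Hypothesis kappaE : forall e, e \in Pairs h ->
  kappa e = sigma e * (1 + kappa e * green R N 0 0).
Hypothesis kappa_le : forall e, e \in Pairs h -> kappa e <= kappa0.
Hypothesis kappa00 : 0 <= kappa0.
Hypothesis h_le : h%:R <= H.

(* a weight differs from 1 by at most 148 * 100 * kappa0, hence from its mean
   by twice as much *)
Let eps := 296 * 100 * kappa0.
(* the value 32 K eps^2 / c for K = 2 and c = 1/6 *)
Let eta := 384 * eps ^+ 2.
(* the bound on the increments of a corrector *)
Let D : R := 201 * 100.
Hypothesis small1 : eps * H ^+ 2 <= 1 / 4.
Hypothesis small2 : eta * D * H ^+ 3 <= 1 / 2.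
Hypothesis small3 : 24 * D * eps * (1 + H * 2) + 4 * eta * D ^+ 2 * H ^+ 3 <= 1 / 24.


Definition profile_product (n : nat) (x : 'I_h -> int * int) : R :=
  \prod_(e in Pairs h) pair_profile (kappa e) n (gap1 x e) (gap2 x e).

Definition corrector_sum (n : nat) (x : 'I_h -> int * int) : R :=
  sum3 (fun i j k => corrector n (embed R (x i)) (embed R (x j)) (embed R (x k))).

Let profile_gt0 e n k l : e \in Pairs h -> 0 < pair_profile (kappa e) n k l.
Proof. by move=> /kappa_ge0 k0; apply: lt_le_trans (pair_profile_ge1 k0 n k l). Qed.

Let profile_product_gt0 n x : 0 < profile_product n x.
Proof. by apply: prodr_gt0 => e eP; apply: profile_gt0. Qed.

Let embed_advance (x : 'I_h -> int * int) a i : embed R (advance x a i) = take_step (embed R (x i)) (a i).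
Proof. by rewrite /embed /advance /take_step /= !intrD. Qed.

Let w n x (e : 'I_h * 'I_h) (a : {ffun 'I_h -> step}) :=
  pair_weight (sigma e) (kappa e) n (gap1 x e) (gap2 x e) (a e.1) (a e.2).

Let gap1_advance (x : 'I_h -> int * int) a e : gap1 (advance x a) e = gap1 x e + step_diff (a e.1).1 (a e.2).1.
Proof. by rewrite /gap1 /advance /step_diff /= opprD addrACA. Qed.

Let gap2_advance (x : 'I_h -> int * int) a e : gap2 (advance x a) e = gap2 x e + step_diff (a e.1).2 (a e.2).2.
Proof. by rewrite /gap2 /advance /step_diff /= opprD addrACA. Qed.

Let weightE n x a :
  collision_weight (advance x a) * profile_product n (advance x a) =
  profile_product n.+1 x * \prod_(e in Pairs h) w n x e a.
Proof.
rewrite /collision_weight /profile_product -!big_split; apply: eq_bigr => e eP /=.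
rewrite /w /pair_weight -gap1_advance -gap2_advance [RHS]mulrC divfK; last first.
  by rewrite lt0r_neq0// profile_gt0.
rewrite /gap1 /gap2 !subr_eq0; congr (_ * _); congr (1 + _ * _).
Qed.

Let pairs_neq e : e \in Pairs h -> e.1 != e.2.
Proof. by rewrite inE neq_ltn => ->. Qed.

Let mean_w n x e : (n < N)%N -> e \in Pairs h -> mean (w n x e) <= 1.
Proof.
move=> nN eP; rewrite /w.
rewrite (mean_coord2 _ (fun s t => pair_weight (sigma e) (kappa e) n (gap1 x e) (gap2 x e) s t)
  (pairs_neq eP)) ?card_prod ?card_bool//.
exact: (mean_pair_weight (sigma_ge0 eP) (kappa_ge0 eP) (kappaE eP) _ _ (ltnW nN)).
Qed.

Let dist_embed (x : 'I_h -> int * int) e : dist2 (embed R (x e.1)) (embed R (x e.2)) = sqnorm R (gap1 x e) (gap2 x e).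
Proof. by rewrite /dist2 /sqnorm /embed /gap1 /gap2 /= !intrB. Qed.

Let w_near1 n x e a : (n < N)%N -> e \in Pairs h ->
  `|w n x e a - 1| <= 148 * 100 * kappa0 * proximity (embed R (x e.1)) (embed R (x e.2)).
Proof.
move=> nN eP; apply: (le_trans (pair_weight_near1 (sigma_ge0 eP) (kappa_ge0 eP)
   (kappaE eP) (gap1 x e) (gap2 x e) (a e.1) (a e.2) (ltnW nN))).
rewrite /proximity dist_embed ler_wpM2r ?invr_ge0 ?sqrtr_ge0//.
by rewrite ler_wpM2l ?kappa_le.
Qed.

Let A_gt0 : (0 < #|{ffun 'I_h -> step}|)%N.
Proof. by rewrite card_ffun expn_gt0 card_prod card_bool. Qed.

Let one_step n x : (n < N)%N ->
  mean (fun a : {ffun 'I_h -> step} => (\prod_(e in Pairs h) w n x e a) *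
     expR (eta * (corrector_sum n (advance x a) - corrector_sum n.+1 x))) <= 1.
Proof.
move=> nN.
pose X e a := w n x e a - mean (w n x e).
pose d i j k (a : {ffun 'I_h -> step}) :=
  corrector_incr (embed R (x i)) (embed R (x j)) (embed R (x k)) n (a i, (a j, a k)).
have dE a : corrector_sum n (advance x a) - corrector_sum n.+1 x =
    sum3 (fun i j k => d i j k a).
  rewrite -[X in _ - X]mul1r -mulNr -sum3Z -sum3D; congr sum3.
  apply/funext => i; apply/funext => j; apply/funext => k.
  by rewrite mulN1r /d /corrector_incr !embed_advance.
have w0 e a : e \in Pairs h -> 0 <= w n x e a.
  by move=> eP; apply: pair_weight_ge0; [exact: sigma_ge0|exact: kappa_ge0].
apply: (@le_trans _ _ (mean (fun a : {ffun 'I_h -> step} =>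
    (\prod_(e in Pairs h) (1 + X e a)) * expR (eta * sum3 (fun i j k => d i j k a))))).
  apply: ler_mean => a; rewrite dE ler_wpM2r ?expR_ge0//.
  apply: ler_prod => e eP; rewrite w0//= /X.
  by have := mean_w x nN eP; lra.
apply: (@one_step_le1 R h step _ (fun i j => proximity (embed R (x i)) (embed R (x j)))
  (fun i j k => proximity3 (embed R (x i)) (embed R (x j)) (embed R (x k))) 2 H
  _ _ _ _ _ _ _ _ _ h_le X d eps D (1 / 6) eta) => //.
- by rewrite card_prod card_bool.
- by move=> *; exact: proximity_ge0.
- by move=> *; exact: proximity_le1.
- by move=> *; exact: proximityC.
- by move=> *; exact: proximity3_ge0.
- by move=> *; exact: proximity3_swap12.
- by move=> *; exact: proximity3_swap23.
- by move=> *; exact: proximity3_le.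
- by move=> i j k _; exact: proximity_mul_le.
- move=> e eP a b ab; rewrite /X /w !ab// !inE eqxx ?orbT//.
- by move=> e eP; rewrite /X meanB mean_cst// subrr.
- move=> e a eP; rewrite /X.
  have -> : w n x e a - mean (w n x e) = (w n x e a - 1) - mean (fun a => w n x e a - 1).
    by rewrite meanB mean_cst//; ring.
  apply: (le_trans (ler_normB _ _)).
  have h1 := w_near1 x a nN eP.
  have h2 : `|mean (fun a => w n x e a - 1)| <=
      148 * 100 * kappa0 * proximity (embed R (x e.1)) (embed R (x e.2)).
    by apply: mean_norm_le => // b; exact: w_near1.
  by rewrite /eps; lra.
- by move=> i j k _ a b ab; rewrite /d !ab// !inE eqxx ?orbT.
- by move=> i j k a _; apply: (le_trans (corrector_incr_norm _ _ _ _ _)).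
- move=> i j k ijk; rewrite /d.
  rewrite (mean_coord3 _ (fun s t u => corrector_incr (embed R (x i)) (embed R (x j)) (embed R (x k)) n (s, (t, u))) ijk) ?card_prod ?card_bool//.
  apply: le_trans (mean_corrector_incr (embed R (x i)) (embed R (x j)) (embed R (x k)) n).
  by rewrite le_eqVlt; apply/orP; left; apply/eqP; apply: eq_mean => -[s [t u]].
- by have := kappa00; rewrite /eps; lra.
- by rewrite /D; lra.
- by rewrite /eta; field.
- by move: small3; lra.
- by move=> e a eP; rewrite /X; have := mean_w x nN eP; have := w0 e a eP; lra.
Qed.

(** The bound propagates along the recursion: the one step mean of the right-hand
    side, divided by its value at [n.+1] and [x], is the quantity that
    [one_step_le1] bounds by 1. *)
Lemma partition_function_le n x : (n <= N)%N ->
  partition_function n x <= profile_product n x * expR (eta * corrector_sum n x).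
Proof.
have eta0 : 0 <= eta.
  by rewrite /eta; have := sqr_ge0 eps; move: (eps ^+ 2) => u; lra.
elim: n x => [|n IH] x nN.
  rewrite /= /profile_product big1; last first.
    by move=> e _; rewrite /pair_profile green0 mulr0 addr0.
  rewrite mul1r -[leLHS]expR0 ler_expR mulr_ge0//.
  by apply: sum3_ge0 => *; exact: corrector_ge0.
have cw0 y : 0 <= collision_weight y.
  by apply: prodr_ge0 => e eP; rewrite addr_ge0// mulr_ge0// sigma_ge0.
rewrite /=; apply: (@le_trans _ _ (mean (fun a : {ffun 'I_h -> step} =>
   (profile_product n.+1 x * expR (eta * corrector_sum n.+1 x)) *
   ((\prod_(e in Pairs h) w n x e a) *
     expR (eta * (corrector_sum n (advance x a) - corrector_sum n.+1 x)))))).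
  apply: ler_mean => a.
  apply: (le_trans (ler_wpM2l (cw0 _) (IH (advance x a) (ltnW nN)))).
  rewrite [leLHS]mulrA weightE mulrBr expRD expRN.
  set E := expR (_ * corrector_sum n.+1 x).
  have E0 : E != 0 by rewrite lt0r_neq0 ?expR_gt0.
  by rewrite le_eqVlt; apply/orP; left; apply/eqP; field.
rewrite meanZ ler_piMr ?one_step// mulr_ge0 ?expR_ge0//.
exact/ltW/profile_product_gt0.
Qed.

End PartitionFunction.

(** * Explicit constants *)

Section Asymptotics.
Variable R : realType.

(** Makes the bound 296 * 100 / L on the variation of the weights, times h^2 and
    times the bound 201 * 100 on the increments of the correctors, smaller than
    10^-4. *)
Definition size_threshold : R := (296 * 100 * (201 * 100) * 100 ^+ 2)^-1.

(** The first summand is L^2 times the weight of the correctors in the exponent,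
    times 400, a bound on their value at the origin divided by L; the profiles of
    the pairs contribute 1. *)
Definition error_constant : R := 384 * (296 * 100) ^+ 2 * 400 + 1.

Lemma size_threshold_gt0 : 0 < size_threshold.
Proof. by rewrite invr_gt0; lra. Qed.

Lemma pi_le4 : pi <= 4 :> R.
Proof. by have := @pihalf_lt2 R; lra. Qed.

Lemma mul_green_origin_le (N : nat) (b : R) :
  0 <= b <= 1 / 288 -> 1 <= ln N%:R :> R ->
  (expR (pi * b / ln N%:R) - 1) * green R N 0 0 <= b * (1 + 3 / ln N%:R).
Proof.
move=> /andP[b0 b1] L1; set L : R := ln N%:R.
have L0 : 0 < L by apply: lt_le_trans L1.
have N0 : (0 < N)%N by rewrite lt0n; apply: contraTneq L1 => ->; rewrite ln0// -ltNge.
have p0 := @pi_gt0 R; have p4 := pi_le4.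
set u := pi * b / L.
have u0 : 0 <= u by rewrite divr_ge0 ?mulr_ge0 ?(ltW p0) ?(ltW L0).
have uL : u <= 1 / 72 / L.
  rewrite ler_wpM2r ?invr_ge0 ?(ltW L0)//.
  by have := ler_wpM2r b0 p4; lra.
have L'1 : L^-1 <= 1 by rewrite invf_le1.
have L'0 : 0 < L^-1 by rewrite invr_gt0.
have e1 : expR u - 1 <= u * (1 + L^-1).
  have : expR u <= 1 + u + 2 * u ^+ 2 by apply: expR_le_quadratic; lra.
  have : u * u <= u * (1 / 72 / L) by rewrite ler_wpM2l.
  have : 0 <= u * L^-1 by rewrite mulr_ge0// ltW.
  lra.
have g1 := green_origin_le R N0.
have g0 : 0 <= green R N 0 0 by exact: green_ge0.
have e0 : 0 <= expR u - 1 by have := expR_ge1Dx u; lra.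
apply: (le_trans (ler_pM e0 g0 e1 g1)); rewrite -/L.
have -> : u * (1 + L^-1) * ((1 + L) / pi) = b * ((1 + L^-1) ^+ 2).
  rewrite /u; move: (pi : R) (lt0r_neq0 p0) => p p_neq0.
  by field; rewrite p_neq0 lt0r_neq0.
rewrite ler_wpM2l//.
have : L^-1 * L^-1 <= L^-1 * 1 by rewrite ler_wpM2l// ltW.
lra.
Qed.

Lemma inv_profile_le (b t x : R) : 0 <= b <= 1 / 288 -> 0 < t <= 1 ->
  x <= b * (1 + 3 * t) -> (1 - x)^-1 <= (1 - b)^-1 * expR t.
Proof.
move=> /andP[b0 b1] /andP[t0 t1] xb.
have bt : b * t <= 1 / 288 * t by rewrite ler_wpM2r// ltW.
have btt : b * t * t <= 1 / 288 * t.
  by apply: le_trans bt; rewrite ler_piMr// mulr_ge0// ltW.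
have x1 : 0 < 1 - x by lra.
have b1' : 0 < 1 - b by lra.
rewrite -[leLHS]div1r ler_pdivrMr// -mulrA ler_pdivlMl// mulr1.
have ht : 1 + t <= expR t by rewrite expR_ge1Dx.
apply: (@le_trans _ _ ((1 + t) * (1 - x))); last by rewrite ler_wpM2r// ltW.
have : (1 + t) * (1 - b * (1 + 3 * t)) <= (1 + t) * (1 - x).
  by rewrite ler_wpM2l//; lra.
lra.
Qed.

Lemma smallness (eps H D : R) : 0 <= eps -> 1 <= H -> 1 <= D ->
  eps * H ^+ 2 * (D * 100 ^+ 2) <= 1 ->
  [/\ eps * H ^+ 2 <= 1 / 4, 384 * eps ^+ 2 * D * H ^+ 3 <= 1 / 2 &
   24 * D * eps * (1 + H * 2) + 4 * (384 * eps ^+ 2) * D ^+ 2 * H ^+ 3 <= 1 / 24].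
Proof.
move=> eps0 H1 D1 tau; set U := eps * H ^+ 2 in tau *.
have UE : U = eps * H ^+ 2 by [].
move: U UE tau => U UE tau.
have U0 : 0 <= U by rewrite UE mulr_ge0// sqr_ge0.
have H0 : 0 <= H by lra.
have D0 : 0 <= D by lra.
have eps3 : eps ^+ 2 * H ^+ 3 <= U ^+ 2.
  have -> : U ^+ 2 = eps ^+ 2 * H ^+ 3 * H by rewrite UE; ring.
  by rewrite ler_peMr// mulr_ge0 ?sqr_ge0// exprn_ge0.
have HH : H <= H * H by rewrite ler_peMr.
have epsH : eps * (1 + H * 2) <= 3 * U.
  have h1 : eps * H <= eps * (H * H) by rewrite ler_wpM2l.
  have h2 : eps * 1 <= eps * (H * H) by rewrite ler_wpM2l//; lra.
  by rewrite UE expr2; lra.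
have DU : D * U <= 1 / 100 ^+ 2 by lra.
have DU0 : 0 <= D * U by rewrite mulr_ge0.
have DU2 : (D * U) ^+ 2 <= 1 / 100 ^+ 2 * (D * U) by rewrite expr2 ler_wpM2r.
have UDU : U <= D * U by rewrite ler_peMl.
have DU2' : D * U ^+ 2 <= (D * U) ^+ 2.
  by rewrite exprMn ler_wpM2r ?sqr_ge0// expr2 ler_peMr.
have De3 : D * (eps ^+ 2 * H ^+ 3) <= D * U ^+ 2 by rewrite ler_wpM2l.
have D2e3 : D ^+ 2 * (eps ^+ 2 * H ^+ 3) <= (D * U) ^+ 2.
  by rewrite exprMn ler_wpM2l// sqr_ge0.
have DepsH : D * (eps * (1 + H * 2)) <= D * (3 * U) by rewrite ler_wpM2l.
by split; lra.
Qed.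

Lemma corrector_sum0_le (h N : nat) : (2 <= N)%N ->
  @corrector_sum R h N (fun=> (0, 0)) <= h%:R ^+ 3 * (400 * ln N%:R).
Proof.
move=> N2; have N2' : 2 <= N%:R :> R by rewrite ler_nat.
have L0 : 0 <= ln N%:R :> R by rewrite ln_ge0//; lra.
have c0 : 0 <= 400 :> R by lra.
pose o := embed R (0, 0); have cE : corrector N o o o <= 400 * ln N%:R.
  have d0 : dist2 (0, 0) (0, 0) = 0 :> R by rewrite /dist2 /= subrr expr0n addr0.
  rewrite /corrector /o /embed /= mulr0z /dist3 d0 !addr0 add0r.
  have sh0 := shift_gt0 R; have shE : shift R = 100 ^+ 2 by [].
  move: (shift R) sh0 shE => sh sh0 shE.
  have q0 : Num.sqrt sh != 0 by rewrite lt0r_neq0 ?sqrtr_gt0.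
  rewrite divff// subrr addr0; apply: ler_wpM2l; first exact: c0.
  have n0 : 0 < 3 * N%:R + sh by lra.
  have n1 : 0 < N%:R :> R by lra.
  rewrite -ln_div ?posrE// ler_ln ?posrE ?divr_gt0//.
  by rewrite ler_pdivrMr// shE; lra.
have := @sum3_le_card R 'I_h _ _ (fun _ _ _ _ => cE) (mulr_ge0 c0 L0).
by rewrite card_ord; exact.
Qed.

Lemma partition_function_bound (N h : nat) (b : 'I_h * 'I_h -> R) :
  (forall e, e \in Pairs h -> 0 <= b e <= 1 / 288) ->
  (h%:R + 1) ^+ 2 <= size_threshold * ln N%:R ->
  partition_function (fun e => expR (pi * b e / ln N%:R) - 1) N (fun=> (0, 0)) <=
  \prod_(e in Pairs h) (1 - b e)^-1 * expR (error_constant * (h%:R ^+ 3 / ln N%:R)).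
Proof.
move=> hb; set L : R := ln N%:R => hL.
have h0 : 0 <= h%:R :> R by [].
have hL' : 296 * 100 * (201 * 100) * 100 ^+ 2 * (h%:R + 1) ^+ 2 <= L.
  by move: hL; rewrite /size_threshold ler_pdivlMl; last by lra.
have h1 : 1 <= (h%:R + 1) ^+ 2 :> R by nra.
have L1 : 1 <= L by lra.
have L0 : 0 < L by lra.
have L'0 : 0 < L^-1 by rewrite invr_gt0.
have L'1 : L^-1 <= 1 by rewrite invf_le1.
have N2 : (2 <= N)%N.
  rewrite ltnNge; apply/negP => N1; suff : L <= 0 by lra.
  by rewrite /L ln_le0// lern1.
pose s e : R := expR (pi * b e / L) - 1.
have p0 := @pi_gt0 R; have p4 := pi_le4.
have u0 e : e \in Pairs h -> 0 <= pi * b e / L.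
  by move=> /hb/andP[b0 _]; rewrite divr_ge0 ?mulr_ge0 ?(ltW p0) ?(ltW L0).
have s0 e : e \in Pairs h -> 0 <= s e.
  by move=> /u0 eP; rewrite subr_ge0 -[leLHS]expR0 ler_expR.
pose G := green R N 0 0.
have sG e : e \in Pairs h -> s e * G <= b e * (1 + 3 * L^-1).
  by move=> /hb be; apply: mul_green_origin_le.
have sG12 e : e \in Pairs h -> s e * G <= 1 / 72.
  move=> eP; have /andP[b0 b1] := hb e eP; apply: (le_trans (sG e eP)).
  have : b e * L^-1 <= 1 / 288 * 1 by rewrite ler_pM// ltW.
  lra.
pose k e := s e / (1 - s e * G).
have d0 e : e \in Pairs h -> 0 < 1 - s e * G by move=> /sG12; lra.
have k0 e : e \in Pairs h -> 0 <= k e.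
  by move=> eP; rewrite divr_ge0 ?s0// ltW ?d0.
have kE e : e \in Pairs h -> k e = s e * (1 + k e * G).
  by move=> eP; rewrite /k; field; rewrite lt0r_neq0 ?d0.
have kL e : e \in Pairs h -> k e <= L^-1.
  move=> eP; have /andP[b0 b1] := hb e eP.
  rewrite ler_pdivrMr ?d0//.
  have u00 := u0 e eP; rewrite /s; set u := pi * b e / L in u00 *.
  have uL : u <= 1 / 72 * L^-1.
    rewrite ler_wpM2r ?(ltW L'0)//.
    by have := ler_wpM2r b0 p4; lra.
  have e1 : expR u <= 1 + u + 2 * u ^+ 2 by apply: expR_le_quadratic; lra.
  have u2 : u ^+ 2 <= u * 1 by rewrite expr2 ler_wpM2l//; lra.
  have : L^-1 * (s e * G) <= L^-1 * (1 / 72) by rewrite ler_wpM2l ?sG12 ?(ltW L'0).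
  rewrite /s -/u; move: (expR u) e1 => E e1; lra.
have eps0 : 0 <= 296 * 100 * L^-1 by lra.
have H1 : 1 <= h%:R + 1 :> R by lra.
have D1 : 1 <= 201 * 100 :> R by lra.
have tau : 296 * 100 * L^-1 * (h%:R + 1) ^+ 2 * (201 * 100 * 100 ^+ 2) <= 1.
  have -> : 296 * 100 * L^-1 * (h%:R + 1) ^+ 2 * (201 * 100 * 100 ^+ 2) =
    L^-1 * (296 * 100 * (201 * 100) * 100 ^+ 2 * (h%:R + 1) ^+ 2) by ring.
  apply: (le_trans (ler_wpM2l (ltW L'0) hL')).
  by rewrite mulVf ?lexx// lt0r_neq0.
have [small1 small2 small3] := smallness eps0 H1 D1 tau.
have hH : h%:R <= h%:R + 1 :> R by lra.
apply: (le_trans (partition_function_le s0 k0 kE kL (ltW L'0) hH small1 small2 small3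
  (fun=> (0, 0)) (leqnn N))).
apply: (@le_trans _ _ (\prod_(e in Pairs h) ((1 - b e)^-1 * expR L^-1) *
    expR (384 * (296 * 100 * L^-1) ^+ 2 * (h%:R ^+ 3 * (400 * L))))).
  apply: ler_pM; rewrite ?expR_ge0//.
  - apply: prodr_ge0 => e eP; rewrite (le_trans ler01)//.
    by apply: pair_profile_ge1; exact: k0.
  - apply: ler_prod => e eP; rewrite (le_trans ler01) ?pair_profile_ge1 ?k0//=.
    rewrite /pair_profile /gap1 /gap2 /= subrr -/G.
    have -> : 1 + k e * G = (1 - s e * G)^-1 by rewrite /k; field; rewrite lt0r_neq0 ?d0.
    by apply: inv_profile_le; [exact: hb|rewrite L'0 L'1|exact: sG].
  - have e20 := sqr_ge0 (296 * 100 * L^-1).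
    rewrite ler_expR; apply: ler_wpM2l; last exact: corrector_sum0_le.
    by move: (_ ^+ 2) e20 => E E0; lra.
rewrite big_split /= -[leLHS]mulrA; apply: ler_wpM2l.
  by apply: prodr_ge0 => e /hb; rewrite invr_ge0; lra.
rewrite prodr_const -expRM_natl -expRD ler_expR.
have cP : #|Pairs h|%:R <= h%:R ^+ 3 :> R.
  rewrite -natrX ler_nat (leq_trans (max_card _))// card_prod card_ord.
  by case: (h) => // h'; rewrite expnS -mulnn leq_pmull.
have := ler_wpM2r (ltW L'0) cP.
rewrite /error_constant.
have -> : 384 * (296 * 100 * L^-1) ^+ 2 * (h%:R ^+ 3 * (400 * L)) =
  384 * (296 * 100) ^+ 2 * 400 * (h%:R ^+ 3 / L).
  by field; rewrite lt0r_neq0.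
lra.
Qed.

End Asymptotics.

(** * The moment as a partition function *)


(** The unit steps of the lattice in the coordinates rotated by 45 degrees, in
    which the two coordinates of a simple random walk are independent. *)
Definition unit_step (s : step) : int * int :=
  match s with
  | (true, true) => (1, 0)
  | (false, false) => (-1, 0)
  | (true, false) => (0, 1)
  | (false, true) => (0, -1)
  end.

Lemma unit_step_in s : unit_step s \in unit_steps.
Proof. by case: s => [] [] []. Qed.

Lemma unit_step_inj : injective unit_step.
Proof. by move=> [] [] [] [] [] []. Qed.

Section Cylinders.
Context d (T : measurableType d) (R : realType) (P : probability T R).
Variable S : nat -> nat -> T -> int * int.
Hypothesis HS : independent_srws P S.
Variable h : nat.
Local Notation steps := {ffun 'I_h -> step}.

Let S0 i t : S i 0%N t = 0. Proof. by case: HS. Qed.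
Let mincr k A : measurable (increment S k @^-1` A).
Proof. by case: HS => _ + _ _; apply. Qed.
Let Pincr k z : z \in unit_steps -> P (increment S k @^-1` [set z]) = (4^-1)%:E.
Proof. by case: HS => _ _ + _; apply. Qed.
Let indep : mutually_independent P (increment S). Proof. by case: HS. Qed.

Lemma measurable_position i n A : measurable (S i n @^-1` A).
Proof.
elim: n A => [|n IH] A.
  have [A0|A0] := pselect (A 0).
    by rewrite (_ : _ @^-1` _ = setT)//; apply/seteqP; split => t //= _; rewrite S0.
  by rewrite (_ : _ @^-1` _ = set0)//; apply/seteqP; split => t //=; rewrite S0.
rewrite (_ : _ @^-1` _ = \bigcup_(z : int * int) ((S i n @^-1` [set z]) `&`
    (increment S (i, n) @^-1` [set w | A (w + z)]))).
  apply: countable_bigcupT_measurable => [|z]; last exact: measurableI.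
  exact: countableP.
apply/seteqP; split => t /=.
  by move=> At; exists (S i n t) => //; split => //=; rewrite /increment /= subrK.
by move=> [z _ [/= <-]]; rewrite /increment /= subrK.
Qed.

Lemma measurable_collision i j n : measurable [set t | S i n t = S j n t].
Proof.
rewrite (_ : [set t | _] = \bigcup_(z : int * int)
    ((S i n @^-1` [set z]) `&` (S j n @^-1` [set z]))).
  apply: countable_bigcupT_measurable => [|z]; last first.
    by apply: measurableI; exact: measurable_position.
  exact: countableP.
apply/seteqP; split => t /=; first by move=> e; exists (S i n t).
by move=> [z _ [/= -> ->]].
Qed.

Definition step_keys (s : seq steps) : seq (nat * nat) :=
  [seq (i, m) | m <- iota 0 (size s), i <- iota 0 h].

Definition key_step (s : seq steps) (k : nat * nat) : step :=
  if insub k.1 is Some i then nth [ffun=> (true, true)] s k.2 i else (true, true).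

Definition cylinder (s : seq steps) : set T :=
  \bigcap_(k in [set` step_keys s])
     (increment S k @^-1` [set unit_step (key_step s k)]).

Lemma cylinderP s t : cylinder s t <-> (forall m (i : 'I_h), (m < size s)%N ->
  increment S (i : nat, m) t = unit_step (nth [ffun=> (true, true)] s m i)).
Proof.
split=> [st m i ms|st [i m] /= /allpairsP[[m' i'] /= []]].
  have := st (i : nat, m); rewrite /= /key_step /= valK; apply.
  by apply/allpairsP; exists (m, i : nat); rewrite !mem_iota /= add0n ms ltn_ord.
rewrite !mem_iota /= !add0n => ms ih [-> ->].
by rewrite /key_step /= insubT /= -(st m' (Ordinal ih)).
Qed.

Lemma measurable_cylinder s : measurable (cylinder s).
Proof.
by apply: fin_bigcap_measurable => [|k _]; [exact: finite_seq|exact: mincr].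
Qed.

Lemma prob_cylinder s : P (cylinder s) = ((#|{: steps}|%:R^-1 : R) ^+ size s)%:E.
Proof.
rewrite indep; last first.
  rewrite allpairs_uniq ?iota_uniq// => -[m i] [m' i'] _ _ /= [-> ->].
  by [].
under eq_bigr do rewrite Pincr ?unit_step_in//.
rewrite prodEFin; congr (_%:E).
rewrite big_const_seq count_predT iter_mulr_1 size_allpairs !size_iota.
rewrite mulnC exprM; congr (_ ^+ _).
by rewrite card_ffun card_prod card_bool card_ord natrX exprVn.
Qed.

Lemma prob_cylinder_rcons s a :
  P (cylinder (rcons s a)) = (P (cylinder s) * (#|{: steps}|%:R^-1 : R)%:E)%E.
Proof. by rewrite !prob_cylinder size_rcons exprSr EFinM. Qed.

Lemma sub_cylinder_rcons s a : cylinder (rcons s a) `<=` cylinder s.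
Proof.
move=> t /cylinderP st; apply/cylinderP => m i ms.
by rewrite st ?size_rcons ?leqW// nth_rcons ms.
Qed.

Lemma trivIset_cylinder_rcons s : trivIset setT (fun a => cylinder (rcons s a)).
Proof.
move=> a b _ _ [t [/cylinderP ta /cylinderP tb]]; apply/ffunP => i.
have := ta (size s) i; have := tb (size s) i.
rewrite !size_rcons !nth_rcons ltnn eqxx => /(_ (ltnSn _)) -> /(_ (ltnSn _)).
by move=> /unit_step_inj.
Qed.

Definition position (s : seq steps) : 'I_h -> int * int :=
  foldl (@advance h) (fun=> (0, 0)) s.

Lemma position_rcons s a : position (rcons s a) = advance (position s) a.
Proof. by rewrite /position -cats1 foldl_cat. Qed.

(** Rotated coordinates of the walk are twice the count of forward moves minus
    the time, so that walks meet exactly when their counts agree. *)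
Lemma position_cylinder s t (i : 'I_h) : cylinder s t ->
  (S i (size s) t).1 + (S i (size s) t).2 = 2 * (position s i).1 - (size s)%:Z /\
  (S i (size s) t).1 - (S i (size s) t).2 = 2 * (position s i).2 - (size s)%:Z.
Proof.
elim/last_ind: s => [_|s a IH st]; first by rewrite /= S0.
have [h1 h2] := IH (sub_cylinder_rcons st).
have /cylinderP/(_ (size s) i) := st.
rewrite size_rcons ltnSn nth_rcons ltnn eqxx position_rcons => /(_ isT).
rewrite /increment /= /advance /= => /(canRL (subrK _)) ->.
by move: h1 h2; case: (S i (size s) t) => u v /=; case: (a i) => [] [] [] /= h1 h2; split; lia.
Qed.

Lemma collision_cylinder s t (i j : 'I_h) : cylinder s t ->
  (S i (size s) t == S j (size s) t) = (position s i == position s j).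
Proof.
move=> st; have [] := position_cylinder i st; have [] := position_cylinder j st.
case: (S i _ t) => u v; case: (S j _ t) => u' v' /=.
case: (position s i) => p q; case: (position s j) => p' q' /= h1 h2 h3 h4.
rewrite !xpair_eqE; apply/andP/andP => -[/eqP e1 /eqP e2]; split; apply/eqP; lia.
Qed.

Variable sigma : 'I_h * 'I_h -> R.
Hypothesis sigma_ge0 : forall e, e \in Pairs h -> 0 <= sigma e.

Definition weight_at (n : nat) (t : T) : R :=
  \prod_(e in Pairs h) (1 + sigma e * (S e.1 n t == S e.2 n t)%:R).

Lemma weight_at_ge0 n t : 0 <= weight_at n t.
Proof. by apply: prodr_ge0 => e eP; rewrite addr_ge0// mulr_ge0// sigma_ge0. Qed.

Lemma measurable_weight_at n : measurable_fun setT (weight_at n).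
Proof.
rewrite (_ : weight_at n = fun t => \prod_(e <- enum (Pairs h))
    (1 + sigma e * \1_[set t | S e.1 n t = S e.2 n t] t)); last first.
  apply/funext => t; rewrite big_enum /=; apply: eq_bigr => e _.
  rewrite indicE; congr (1 + _ * (nat_of_bool _)%:R).
  by apply/eqP/idP; rewrite inE.
apply: measurable_prod => e _; apply: measurable_funD => //.
apply: measurable_funM => //; apply: measurable_indic.
exact: measurable_collision.
Qed.

Lemma weight_at_cylinder s t :
  cylinder s t -> weight_at (size s) t = collision_weight sigma (position s).
Proof.
by move=> st; apply: eq_bigr => e _; rewrite (collision_cylinder _ _ st).
Qed.

Let A_gt0 : (0 < #|{: steps}|)%N.
Proof. by rewrite card_ffun expn_gt0 card_prod card_bool. Qed.

(* the continuations of a cylinder cover it up to a null set *)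
Let prob_continuations s :
  P (cylinder s `\` \big[setU/set0]_(a <- enum {: steps}) cylinder (rcons s a)) = 0.
Proof.
set U := \big[setU/set0]_(a <- _) _.
have mU : measurable U.
  by apply: bigsetU_measurable => a _; exact: measurable_cylinder.
have Us : U `<=` cylinder s.
  rewrite /U -bigcup_seq => t [a _]; exact: sub_cylinder_rcons.
have Pfin : (P (cylinder s) < +oo)%E by rewrite prob_cylinder ltry.
suff PU : P U = P (cylinder s).
  rewrite measureD; [|exact: measurable_cylinder|exact: mU|exact: Pfin].
  rewrite (setIidr Us); transitivity (P (cylinder s) - P (cylinder s))%E.
    by congr (_ - _)%E; exact: PU.
  by rewrite prob_cylinder -EFinB subrr.
rewrite -[LHS]mul1e -integral_cst// (ge0_integral_bigsetU P)//.
- rewrite (eq_bigr (fun=> (P (cylinder s) * (#|{: steps}|%:R^-1 : R)%:E)%E)); last first.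
    move=> a _; rewrite integral_cst; last exact: measurable_cylinder.
    by rewrite mul1e; exact: prob_cylinder_rcons.
  rewrite prob_cylinder -EFinM big_enum /= sumEFin sumr_const; congr (_%:E).
  rewrite -[LHS]mulr_natl mulrCA mulfV ?mulr1//.
  by rewrite pnatr_eq0 -lt0n.
- by move=> a; exact: measurable_cylinder.
- exact: enum_uniq.
- by move=> a b _ _; exact: (@trivIset_cylinder_rcons s a b).
Qed.

(** Conditioning on one more step multiplies the probability of a cylinder by
    the uniform weight of the step, as in the recursion. *)
Lemma integral_cylinder n s :
  (\int[P]_(t in cylinder s) (\prod_(j < n) weight_at (size s + j).+1 t)%:E =
   ((#|{: steps}|%:R^-1 : R) ^+ size s * partition_function sigma n (position s))%:E)%E.
Proof.
elim: n s => [|n IH] s.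
  under eq_integral do rewrite big_ord0.
  rewrite integral_cst; last exact: measurable_cylinder.
  by rewrite mul1e mulr1; exact: prob_cylinder.
pose f (n : nat) (s : seq steps) t := \prod_(j < n) weight_at (size s + j).+1 t.
have mf k r D : measurable_fun D (fun t => (f k r t)%:E).
  apply/measurable_EFinP; apply: (measurable_funS measurableT (@subsetT _ _)).
  by apply: measurable_prod => j _; exact: measurable_weight_at.
have f0 k r t : (0 <= (f k r t)%:E)%E.
  by rewrite lee_fin; apply: prodr_ge0 => j _; exact: weight_at_ge0.
set U := \big[setU/set0]_(a <- enum {: steps}) cylinder (rcons s a).
have mU : measurable U.
  by apply: bigsetU_measurable => a _; exact: measurable_cylinder.
have Us : U `<=` cylinder s.
  rewrite /U -bigcup_seq => t [a _]; exact: sub_cylinder_rcons.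
rewrite (ge0_negligible_integral _ _ _ _ (prob_continuations s)); last 4 first.
- by apply: measurableD => //; exact: measurable_cylinder.
- exact: measurable_cylinder.
- exact: mf.
- by move=> t _; exact: f0.
rewrite setDD (setIidr Us) ge0_integral_bigsetU//; last 5 first.
- by move=> a; exact: measurable_cylinder.
- exact: enum_uniq.
- by move=> a b _ _; exact: (@trivIset_cylinder_rcons s a b).
- exact: mf.
- by move=> t _; exact: f0.
rewrite (eq_bigr (fun a => ((#|{: steps}|%:R^-1 : R) ^+ size s * (#|{: steps}|%:R^-1 *
    (collision_weight sigma (advance (position s) a) *
     partition_function sigma n (advance (position s) a))))%:E)); last first.
  move=> a _.
  under eq_integral => t /set_mem ta.
    rewrite big_ord_recl /= addn0 -(size_rcons s a) (weight_at_cylinder ta).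
    rewrite position_rcons.
    under eq_bigr do rewrite /bump leq0n addnA addn1 -(size_rcons s a).
    rewrite EFinM.
    over.
  rewrite ge0_integralZl_EFin//; last 4 first.
  - exact: measurable_cylinder.
  - by move=> t _; exact: f0.
  - exact: mf.
  - by apply: prodr_ge0 => e eP; rewrite addr_ge0// mulr_ge0// sigma_ge0.
  rewrite IH position_rcons size_rcons exprSr -EFinM.
  by congr (_%:E); ring.
rewrite sumEFin; congr (_%:E); rewrite -!mulr_sumr; congr (_ * (_ * _)).
exact: big_enum.
Qed.

End Cylinders.

Lemma moment_partition_function d (T : measurableType d) (R : realType)
    (P : probability T R) (S : nat -> nat -> T -> int * int) (N h : nat)
    (b : 'I_h * 'I_h -> R) : independent_srws P S ->
  (forall e, e \in Pairs h -> 0 <= b e) ->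
  moment P S N b =
  (partition_function (fun e => expR (pi * b e / ln N%:R) - 1) N (fun=> (0, 0)))%:E.
Proof.
move=> HS b0; rewrite /moment unlock.
have lnN : 0 <= ln N%:R :> R by case: N => [|n]; [rewrite ln0|rewrite ln_ge0// ler1n].
set sigma := fun e => expR (pi * b e / ln N%:R) - 1.
have sigma0 e : e \in Pairs h -> 0 <= sigma e.
  move=> eP; rewrite subr_ge0 -[leLHS]expR0 ler_expR divr_ge0// mulr_ge0 ?b0//.
  exact: pi_ge0.
have := @integral_cylinder d T R P S HS h sigma sigma0 N [::].
rewrite expr0 mul1r => <-.
have -> : cylinder S ([::] : seq {ffun 'I_h -> step}) = [set: T] by apply/seteqP; split => // t _ k.
apply: eq_integral => t _; congr (_%:E).
rewrite /weight_at exchange_big expR_sum /=; apply: eq_bigr => e _.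
rewrite /collision_time big_add1 /= big_mkord natr_sum mulr_sumr expR_sum.
apply: eq_bigr => j _; rewrite add0n.
by case: (S e.1 j.+1 t == S e.2 j.+1 t); rewrite /sigma /= ?mulr1 ?mulr0 ?expR0 ?addr0// addrC subrK.
Qed.

(** * Limits and the theorem *)

Section Limits.
Variable R : realType.

Lemma limn_esup_le_near (u : nat -> \bar R) (l : \bar R) :
  (\forall n \near \oo, (u n <= l)%E) -> (limn_esup u <= l)%E.
Proof.
move=> ul; apply: (@le_trans _ _ (ereal_sup (u @` [set n | (u n <= l)%E]))).
  by apply: ereal_inf_lbound; exists [set n | (u n <= l)%E].
by apply: ge_ereal_sup => _ [n nl <-].
Qed.

Lemma near_ln_ge (M : R) : \forall N \near \oo, M <= ln N%:R.
Proof.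
near=> N; have NM : expR M <= N%:R by near: N; exact: nbhs_infty_ger.
by rewrite -[leLHS]expRK ler_ln// posrE ?expR_gt0// (lt_le_trans _ NM)// expR_gt0.
Unshelve. all: by end_near. Qed.

Lemma near_le_of_cvg0 (f : nat -> R) (e : R) : 0 < e ->
  f N @[N --> \oo] --> 0 -> \forall N \near \oo, f N <= e.
Proof.
move=> e0 /cvgr0Pnorm_le/(_ _ e0); apply: filterS => N.
exact: le_trans (ler_norm _).
Qed.

Lemma near_small_size_sqrt (h : nat -> nat) :
  (h N)%:R / Num.sqrt (ln (N%:R : R)) @[N --> \oo] --> (0 : R) ->
  \forall N \near \oo, ((h N)%:R + 1) ^+ 2 <= size_threshold R * ln N%:R.
Proof.
move=> hlim; set c0 := size_threshold R; have c0_gt0 : 0 < c0 := size_threshold_gt0 R.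
near=> N; set L : R := ln N%:R.
have L1 : 1 <= L by rewrite /L; near: N; exact: near_ln_ge.
have L4 : 4 / c0 <= L by rewrite /L; near: N; exact: near_ln_ge.
have hL : (h N)%:R / Num.sqrt L <= Num.sqrt c0 / 2.
  by rewrite /L; near: N; apply: near_le_of_cvg0 => //; rewrite divr_gt0// sqrtr_gt0.
have sL : 0 < Num.sqrt L by rewrite sqrtr_gt0; lra.
have h2 : (h N)%:R ^+ 2 <= c0 / 4 * L.
  move: hL; rewrite ler_pdivrMr// => hL.
  have sc : 0 <= Num.sqrt c0 / 2 by rewrite divr_ge0 ?sqrtr_ge0.
  have -> : c0 / 4 * L = (Num.sqrt c0 / 2 * Num.sqrt L) ^+ 2.
    rewrite exprMn expr_div_n !sqr_sqrtr ?(ltW c0_gt0)//; first by field.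
    by lra.
  by rewrite ler_pXn2r// nnegrE ?mulr_ge0// sqrtr_ge0.
have : 4 <= c0 * L by move: L4; rewrite ler_pdivrMr// mulrC.
have := sqr_ge0 ((h N)%:R - 1 : R); lra.
Unshelve. all: by end_near. Qed.

Lemma near_small_size_cbrt (h : nat -> nat) :
  (h N)%:R / ln (N%:R : R) `^ 3^-1 @[N --> \oo] --> (0 : R) ->
  \forall N \near \oo, ((h N)%:R + 1) ^+ 2 <= size_threshold R * ln N%:R.
Proof.
move=> hlim; set c0 := size_threshold R; have c0_gt0 : 0 < c0 := size_threshold_gt0 R.
pose M := 4 / c0 + 1.
have M0 : 0 < 4 / c0 by rewrite divr_gt0.
near=> N; set L : R := ln N%:R; set p := L `^ 3^-1.
have L1 : M ^+ 3 <= L by rewrite /L; near: N; exact: near_ln_ge.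
have hp : (h N)%:R / p <= 1 by rewrite /p /L; near: N; exact: near_le_of_cvg0.
have M30 : 0 < M ^+ 3 by rewrite exprn_gt0// /M; lra.
have L0 : 0 < L by apply: lt_le_trans L1.
have p0 : 0 < p by rewrite powR_gt0.
have p3 : p ^+ 3 = L by rewrite -powR_mulrn ?(ltW p0)// -powRrM mulVf// powRr1// ltW.
have pM : M <= p.
  by rewrite -(ler_pXn2r (_ : 0 < 3)%N) ?p3// nnegrE ?(ltW p0)// /M; lra.
have hp' : (h N)%:R <= p by move: hp; rewrite ler_pdivrMr// mul1r.
have h0 : 0 <= (h N)%:R :> R by [].
have c0p : 4 <= c0 * p.
  have : 4 / c0 <= p by move: pM; rewrite /M; lra.
  by rewrite ler_pdivrMr// mulrC.
have p1 : 1 <= p by move: pM; rewrite /M; lra.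
rewrite -p3; apply: (@le_trans _ _ (4 * p ^+ 2)).
  have -> : 4 * p ^+ 2 = (2 * p) ^+ 2 by ring.
  by rewrite ler_pXn2r// ?nnegrE; lra.
rewrite [p ^+ 3]exprS mulrA ler_wpM2r ?sqr_ge0//.
Unshelve. all: by end_near. Qed.

Lemma near_expR_size_le (h : nat -> nat) (C e : R) : 0 < C -> 0 < e ->
  (h N)%:R / ln (N%:R : R) `^ 3^-1 @[N --> \oo] --> (0 : R) ->
  \forall N \near \oo, expR (C * ((h N)%:R ^+ 3 / ln N%:R)) <= 1 + e.
Proof.
move=> C0 e0 hlim.
have l0 : 0 < ln (1 + e) / C by rewrite divr_gt0// ln_gt0//; lra.
pose de := Num.min 1 (ln (1 + e) / C).
have de0 : 0 < de by rewrite lt_min ltr01.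
near=> N; set L : R := ln N%:R; set p := L `^ 3^-1.
have L1 : 1 <= L by rewrite /L; near: N; exact: near_ln_ge.
have L0 : 0 < L by apply: lt_le_trans L1.
have p0 : 0 < p by rewrite powR_gt0.
have p3 : p ^+ 3 = L by rewrite -powR_mulrn ?(ltW p0)// -powRrM mulVf// powRr1// ltW.
have hp : (h N)%:R / p <= de by rewrite /p /L; near: N; exact: near_le_of_cvg0.
rewrite -p3 -expr_div_n -[leRHS]lnK ?posrE; last by lra.
rewrite ler_expR mulrC -ler_pdivlMr//.
have q0 : 0 <= (h N)%:R / p by rewrite divr_ge0// ltW.
apply: (@le_trans _ _ ((h N)%:R / p)); last by rewrite (le_trans hp)// ge_min lexx orbT.
have q1 : (h N)%:R / p <= 1 by rewrite (le_trans hp)// ge_min lexx.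
by rewrite exprS ler_piMr// exprn_ile1.
Unshelve. all: by end_near. Qed.

End Limits.

Lemma moment_le d (T : measurableType d) (R : realType) (P : probability T R)
    (S : nat -> nat -> T -> int * int) (N h : nat) (b : 'I_h * 'I_h -> R) :
  independent_srws P S ->
  (forall e, e \in Pairs h -> 0 <= b e <= 1 / 288) ->
  (h%:R + 1) ^+ 2 <= size_threshold R * ln N%:R ->
  (moment P S N b <=
   (\prod_(e in Pairs h) (1 - b e)^-1 *
    expR (error_constant R * (h%:R ^+ 3 / ln N%:R)))%:E)%E.
Proof.
move=> HS hb hN; rewrite moment_partition_function//; last first.
  by move=> e /hb/andP[].
by rewrite lee_fin; exact: partition_function_bound.
Qed.

Theorem theorem1p3 (R : realType) (bbar : R) (hbbar : 0 < bbar < 72^-1)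
    (hCZ : Cosco_Zeitouni bbar) (bmin bmax : R) (hbmin : 0 < bmin)
    (hbminmax : bmin <= bmax) (hbmax : bmax < 4^-1 * bbar) :
  (exists c C : R, [/\ 0 < c, 0 < C &
    forall (d : measure_display) (T : measurableType d) (P : probability T R)
      (S : nat -> nat -> T -> int * int), independent_srws P S ->
    forall (h : nat -> nat) (b : forall N, 'I_(h N) * 'I_(h N) -> R),
      (forall N e, e \in Pairs (h N) -> bmin <= b N e <= bmax) ->
      h N @[N --> \oo] --> \oo ->
      (h N)%:R / Num.sqrt (ln (N%:R : R)) @[N --> \oo] --> (0 : R) ->
      \forall N \near \oo,
        (moment P S N (b N) <=
         ((\prod_(e in Pairs (h N)) (1 - b N e)^-1) *
            expR (C * ((h N)%:R ^+ 3 / ln N%:R + (h N)%:R ^+ 6 / ln N%:R ^+ 2))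
          + expR (- c * (h N)%:R ^+ 2))%:E)%E]) /\
  (forall (d : measure_display) (T : measurableType d) (P : probability T R)
      (S : nat -> nat -> T -> int * int), independent_srws P S ->
    forall (h : nat -> nat) (b : forall N, 'I_(h N) * 'I_(h N) -> R),
      (forall N e, e \in Pairs (h N) -> bmin <= b N e <= bmax) ->
      (h N)%:R / ln (N%:R : R) `^ 3^-1 @[N --> \oo] --> (0 : R) ->
      (limn_esup (fun N => moment P S N (b N) *
         (\prod_(e in Pairs (h N)) (1 - b N e))%:E) <= 1)%E).
Proof.
have C0 : 0 < error_constant R.
  by rewrite /error_constant; lra.
have small x : bmin <= x <= bmax -> 0 <= x <= 1 / 288.
  by move: hbbar => /andP[? ?] /andP[? ?]; apply/andP; split; lra.
split.
  exists 1, (error_constant R); split => // d T P S HS h b hb _ hlim.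
  near=> N.
  have hN : ((h N)%:R + 1) ^+ 2 <= size_threshold R * ln N%:R.
    by near: N; exact: near_small_size_sqrt.
  have hbN e : e \in Pairs (h N) -> 0 <= b N e <= 1 / 288 by move=> /hb/small.
  apply: (le_trans (moment_le HS hbN hN)); rewrite lee_fin.
  apply: (@le_trans _ _ (\prod_(e in Pairs (h N)) (1 - b N e)^-1 *
    expR (error_constant R * ((h N)%:R ^+ 3 / ln N%:R + (h N)%:R ^+ 6 / ln N%:R ^+ 2)))).
    rewrite ler_wpM2l//.
      by apply: prodr_ge0 => e /hbN; rewrite invr_ge0; lra.
    by rewrite ler_expR ler_wpM2l ?(ltW C0)// lerDl divr_ge0 ?sqr_ge0// exprn_ge0.
  by rewrite lerDl expR_ge0.
move=> d T P S HS h b hb hlim; apply/lee_addgt0Pr => e e0.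
apply: limn_esup_le_near; near=> N.
have hN : ((h N)%:R + 1) ^+ 2 <= size_threshold R * ln N%:R.
  by near: N; exact: near_small_size_cbrt.
have hbN e' : e' \in Pairs (h N) -> 0 <= b N e' <= 1 / 288 by move=> /hb/small.
have p0 : 0 <= \prod_(e' in Pairs (h N)) (1 - b N e').
  by apply: prodr_ge0 => e' /hbN; lra.
apply: (@le_trans _ _ ((\prod_(e' in Pairs (h N)) (1 - b N e')^-1 *
    expR (error_constant R * ((h N)%:R ^+ 3 / ln N%:R)))%:E *
    (\prod_(e' in Pairs (h N)) (1 - b N e'))%:E)%E).
  by apply: lee_wpmul2r; rewrite ?lee_fin// moment_le.
rewrite -EFinM lee_fin mulrAC -big_split /= big1 ?mul1r; last first.
  by move=> e' /hbN e'b; rewrite mulVf// lt0r_neq0//; lra.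
by near: N; exact: near_expR_size_le.
Unshelve. all: by end_near. Qed.
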